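(* Let $d(C_1,C_2)=\frac12\log\langle C_1,C_2;Z_1,Z_2\rangle$ be the distance between two cycles $C_1$ and $C_2$, with the associated cycles $C$, $Z_1$, $Z_2$, as defined in the context. Then: (i) The distance $d$ is M\''obius invariant. (ii) For zero radius cycles $C_1$, $C_2$ the formula $d(C_1,C_2)=\frac12\log\langle C_1,C_2;Z_1,Z_2\rangle$ coincides with the Lobachevsky metric on the upper half-plane. (iii) For any cycle $C_3$ orthogonal to $C$ the (signed) distance is additive: $d(C_1,C_3)=d(C_1,C_2)+d(C_2,C_3)$. (iv) If the centres of $C_1=(k_1,l_1,n_1,m_1)$ and $C_2=(k_2,l_2,n_2,m_2)$ are on the imaginary axis (therefore $Z_1$ and $Z_2$ are zero and infinity), then $$d(C_1,C_2)=\log(m_1/k_1)-\log(k_2/m_2).$$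
   Context: A cycle is a point $(k,l,n,m)$ of the real projective space $P\mathbb{R}^3$; it stands for the equation $k(x^2+y^2)-2lx-2ny+m=0$ in $\mathbb{R}^2$ (the solution set may be empty). For $k\neq 0$ its centre is $(l/k,n/k)$, identified with $(l+\mathrm{i}n)/k\in\mathbb{C}$. With $L=l+\mathrm{i}n$ a cycle is represented, up to a non-zero scalar, by the matrix $C=\begin{pmatrix}\overline{L}&-m\\ k&-L\end{pmatrix}$. The bar over a matrix denotes entrywise complex conjugation. The cycles product is $\langle C,C_1\rangle=-\operatorname{tr}(C\overline{C}_1)=km_1+k_1m-2ll_1-2nn_1$; two cycles are orthogonal if their product is $0$. A zero radius cycle is a self-orthogonal cycle; the point $x+\mathrm{i}y$ is represented by $(1,x,y,x^2+y^2)$ and the point at infinity by $(0,0,0,1)$. The real line is the cycle $C_{\mathbb{R}}$ with matrix $\begin{pmatrix}\mathrm{i}&0\\0&\mathrm{i}\end{pmatrix}$, i.e. the equation $y=0$. A M\''obius transformation is a fractional linear transformation $z\mapsto\frac{\alpha z+\beta}{\gamma z+\delta}$ with matrix $M=\begin{pmatrix}\alpha&\beta\\ \gamma&\delta\end{pmatrix}\in\mathrm{SL}_2(\mathbb{R})$; it fixes the real line and acts on cycles by $C\mapsto\overline{M}CM^{-1}$. The cycles cross ratio of four cycles is $$\langle C_1,C_2;C_3,C_4\rangle=\frac{\langle C_1,C_3\rangle}{\langle C_1,C_4\rangle}:\frac{\langle C_2,C_3\rangle}{\langle C_2,C_4\rangle}.$$ Construction of the distance. Let two distinct cycles $C_1$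 and $C_2$ be given, different from the real line $C_{\mathbb{R}}$. Let $C$ be a cycle orthogonal to $C_1$, $C_2$ and $C_{\mathbb{R}}$; in generic position it is unique, though it can be an imaginary cycle (with a negative square of the radius). Consider the cycles orthogonal to $C$, to $C_{\mathbb{R}}$ and to themselves, i.e. the intersection points of $C$ and $C_{\mathbb{R}}$; in general position there are two of them, denoted $Z_1$ and $Z_2$ (for an imaginary $C$ the first coordinates of the points $Z_1$ and $Z_2$ are conjugated complex numbers). The distance between the two cycles is $d(C_1,C_2)=\frac12\log\langle C_1,C_2;Z_1,Z_2\rangle$.
   Formalization: In (iv) the printed formula is false (C1=(1,0,1,1), C2=(1,0,2,4)); it is corrected to d=½(log(m1/k1)−log(m2/k2)) for Z1=0, Z2=∞, which holds when C is unique. Logs in (iii), (iv) are equal modulo iπ, exactly for positive arguments; d in (ii) is up to the order of Z1, Z2. *)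

(* Defs.v *)
From HB Require Import structures.
From mathcomp Require Import all_boot all_order all_algebra.
From mathcomp Require Import complex.
From mathcomp Require Import all_classical all_reals all_analysis.
From mathcomp Require Import ring.

Set Implicit Arguments.
Unset Strict Implicit.
Unset Printing Implicit Defensive.

Import Order.TTheory GRing.Theory Num.Theory.
Import numFieldNormedType.Exports.

Local Open Scope classical_set_scope.
Local Open Scope ring_scope.
Local Open Scope complex_scope.

Local Notation Re := complex.Re.
Local Notation Im := complex.Im.

(* Homogeneous coordinates (k, l, n, m) of the cycle
   k (x^2 + y^2) - 2 l x - 2 n y + m = 0.  Points of projective space are
   handled through [nonzero_cyc] and [same_cycle] (equality up to a non-zero
   scalar).  Genuine cycles have T := R; the intersection points
   Z1, Z2 may be imaginary and have T := R[i]. *)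
Record cyc (T : Type) : Type := Cyc { ck : T; cl : T; cn : T; cm : T }.

Definition nonzero_cyc (T : pzRingType) (C : cyc T) : Prop := C <> Cyc 0 0 0 0.

Definition scale_cyc (T : pzRingType) (a : T) (C : cyc T) : cyc T :=
  Cyc (a * ck C) (a * cl C) (a * cn C) (a * cm C).

Definition same_cycle (T : pzRingType) (C D : cyc T) : Prop :=
  exists2 a : T, a != 0 & D = scale_cyc a C.

Definition cplx (R : pzRingType) (C : cyc R) : cyc R[i] :=
  Cyc (ck C)%:C (cl C)%:C (cn C)%:C (cm C)%:C.

(* Over R[i] this is the bilinear (not the sesquilinear) extension of the
   product of real cycles; [cprod_trace] below is the trace formula. *)
Definition cprod (T : pzRingType) (C D : cyc T) : T :=
  ck C * cm D + ck D * cm C - 2%:R * cl C * cl D - 2%:R * cn C * cn D.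

Definition orthogonal_cyc (T : pzRingType) (C D : cyc T) : Prop :=
  cprod C D = 0.

(* The cycle of the matrix i * Id, with coordinates (0, 0, -1, 0); see
   [cyc_mx_real_line]. *)
Definition real_line (T : pzRingType) : cyc T := Cyc 0 0 (- 1) 0.

Definition point_cyc (R : pzRingType) (z : R[i]) : cyc R :=
  Cyc 1 (Re z) (Im z) (Re z ^+ 2 + Im z ^+ 2).

Definition origin_cyc (T : pzRingType) : cyc T := Cyc 1 0 0 0.
Definition infinity_cyc (T : pzRingType) : cyc T := Cyc 0 0 0 1.

Definition mx2 (T : Type) (a b c d : T) : 'M[T]_2 :=
  \matrix_(i < 2, j < 2)
    if i == ord0 then (if j == ord0 then a else b)
    else (if j == ord0 then c else d).

Section Cycles.
Variable R : realType.
Local Notation C := R[i].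
Local Notation im := (0 +i* 1 : C).

(* For a real cycle, l - i n is the complex conjugate of L = l + i n
   ([cyc_mx_cplx]); for complex coordinates this is the C-linear extension. *)
Definition cyc_mx (X : cyc C) : 'M[C]_2 :=
  mx2 (cl X - im * cn X) (- cm X) (ck X) (- (cl X + im * cn X)).

(* The inverse of [cyc_mx]. *)
Definition mx_cyc (N : 'M[C]_2) : cyc C :=
  Cyc (N ord_max ord0) ((N ord0 ord0 - N ord_max ord_max) / 2%:R)
      (im * (N ord0 ord0 + N ord_max ord_max) / 2%:R) (- N ord0 ord_max).

Definition mxC (M : 'M[R]_2) : 'M[C]_2 := map_mx (real_complex R) M.

Definition mobiusC (M : 'M[R]_2) (X : cyc C) : cyc C :=
  mx_cyc (map_mx conjc (mxC M) *m cyc_mx X *m invmx (mxC M)).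

(* The same action on real cycles; taking real parts loses nothing when
   \det M = 1, see [cplx_mobius]. *)
Definition mobius (M : 'M[R]_2) (D : cyc R) : cyc R :=
  let X := mobiusC M (cplx D) in
  Cyc (Re (ck X)) (Re (cl X)) (Re (cn X)) (Re (cm X)).

Definition cross_ratio (C1 C2 C3 C4 : cyc C) : C :=
  (cprod C1 C3 / cprod C1 C4) / (cprod C2 C3 / cprod C2 C4).

(* The principal argument, in ]-pi, pi], and the principal logarithm of a
   non-zero complex number. *)
Definition Arg (z : C) : R :=
  let t := acos (Re z / Normc.normc z) in
  if 0 <= Im z then t else - t.

Definition Log (z : C) : C := ln (Normc.normc z) +i* Arg z.

(* The cross ratio may be negative (or non-real, for an imaginary C), so half
   of its logarithm is defined only up to multiples of i * pi; [dist] is the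
   principal determination and [eqmod_ipi] is equality up to this ambiguity. *)
Definition dist (C1 C2 : cyc R) (Z1 Z2 : cyc C) : C :=
  Log (cross_ratio (cplx C1) (cplx C2) Z1 Z2) / 2%:R.

Definition eqmod_ipi (u v : C) : Prop :=
  exists j : int, u = v + j%:~R * (pi : R)%:C * im.

Definition triorthogonal (C1 C2 D : cyc R) : Prop :=
  [/\ nonzero_cyc D, orthogonal_cyc D C1, orthogonal_cyc D C2
    & orthogonal_cyc D (real_line R)].

Definition intersection_point (D : cyc R) (Z : cyc C) : Prop :=
  [/\ nonzero_cyc Z, orthogonal_cyc Z (cplx D), orthogonal_cyc Z (real_line C)
    & orthogonal_cyc Z Z].

(* D, Z1 and Z2 arise from C1 and C2 by the construction of the distance.  The
   order of Z1 and Z2 is a free choice, which determines the sign of the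
   distance; the last conjunct says that the cross ratio is defined and
   non-zero. *)
Definition associated (C1 C2 D : cyc R) (Z1 Z2 : cyc C) : Prop :=
  [/\ [/\ nonzero_cyc C1, nonzero_cyc C2, ~ same_cycle C1 C2,
          ~ same_cycle C1 (real_line R) & ~ same_cycle C2 (real_line R)],
      triorthogonal C1 C2 D,
      [/\ intersection_point D Z1, intersection_point D Z2
        & ~ same_cycle Z1 Z2]
    & [/\ cprod (cplx C1) Z1 != 0, cprod (cplx C1) Z2 != 0,
          cprod (cplx C2) Z1 != 0 & cprod (cplx C2) Z2 != 0]].

Definition centre (D : cyc R) : C := (cl D +i* cn D) / (ck D)%:C.

(* The Lobachevsky metric of the upper half-plane is the path metric of
   ds^2 = (dx^2 + dy^2) / y^2.  A C^1 curve on [0, 1] is given by coordinate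
   functions that are C^1 on the whole line, which is no restriction since
   C^1 functions on [0, 1] extend. *)
Definition C1_fun (f : R -> R) : Prop :=
  (forall t, derivable f t 1) /\ continuous (derive1 f).

Definition half_plane_curve (z w : C) (x y : R -> R) : Prop :=
  [/\ C1_fun x, C1_fun y, (forall t, 0 <= t <= 1 -> 0 < y t),
      x 0 +i* y 0 = z & x 1 +i* y 1 = w].

Definition hyperbolic_length (x y : R -> R) : R :=
  \int[lebesgue_measure]_(t in `[0, 1])
    (Num.sqrt ((derive1 x t) ^+ 2 + (derive1 y t) ^+ 2) / y t).

Definition lobachevsky (z w : C) : R :=
  inf [set a | exists x y, half_plane_curve z w x y /\
                           a = hyperbolic_length x y].

Lemma ord2P (P : 'I_2 -> Prop) : P ord0 -> P ord_max -> forall i, P i.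
Proof.
move=> P0 P1 [[|[|//]] lti]; first by have -> : Ordinal lti = ord0 by apply/val_inj.
by have -> : Ordinal lti = ord_max by apply/val_inj.
Qed.

Lemma mulmx2 (T : comNzRingType) (A B : 'M[T]_2) i j :
  (A *m B) i j = A i ord0 * B ord0 j + A i ord_max * B ord_max j.
Proof.
rewrite mxE big_ord_recl big_ord1; congr (_ + A i _ * B _ j); exact/val_inj.
Qed.

Lemma imagM : (im * im : C) = -1.
Proof. by simpc. Qed.

Lemma cyc_mx_cplx (D : cyc R) :
  cyc_mx (cplx D) =
  let L := cl D +i* cn D in mx2 L^* (- (cm D)%:C) (ck D)%:C (- L).
Proof. by rewrite /cyc_mx /=; congr mx2; simpc. Qed.

Lemma cyc_mx_real_line : cyc_mx (cplx (real_line R)) = im%:M.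
Proof.
rewrite cyc_mx_cplx /=; apply/matrixP.
by elim/ord2P; elim/ord2P; rewrite !mxE /=; simpc; rewrite ?opprK ?oppr0.
Qed.

Lemma cprod_trace (C1 C2 : cyc R) :
  (cprod C1 C2)%:C =
  - \tr (cyc_mx (cplx C1) *m map_mx conjc (cyc_mx (cplx C2))).
Proof.
rewrite !cyc_mx_cplx /mxtrace big_ord_recl big_ord1 /=.
have -> : lift ord0 ord0 = ord_max :> 'I_2 by apply/val_inj.
rewrite !mulmx2 !mxE /= /cprod; simpc.
by apply/eqP; rewrite eq_complex /=; apply/andP; split; apply/eqP; ring.
Qed.

Lemma mx_cycK : cancel mx_cyc cyc_mx.
Proof.
move=> N; have n2 : (2%:R : C) != 0 by rewrite pnatr_eq0.
apply/matrixP; elim/ord2P; elim/ord2P; rewrite mxE /= ?opprK // ?mulrA imagM;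
  apply: (mulIf n2); rewrite ?mulNr ?mulrDl ?mulrBl ?mulNr ?mulfVK //; ring.
Qed.

Lemma cyc_mx_mobiusC (M : 'M[R]_2) (X : cyc C) :
  cyc_mx (mobiusC M X) =
  map_mx conjc (mxC M) *m cyc_mx X *m invmx (mxC M).
Proof. exact: mx_cycK. Qed.

Lemma cplx_mobius (M : 'M[R]_2) (D : cyc R) :
  \det M = 1 -> cplx (mobius M D) = mobiusC M (cplx D).
Proof.
move=> detM.
have ME : M ord0 ord0 * M ord_max ord_max - M ord0 ord_max * M ord_max ord0 = 1.
  rewrite -detM (expand_det_row _ ord0) big_ord_recl big_ord1 /cofactor.
  rewrite !det_mx11 !mxE /= !expr0 expr1 mul1r mulN1r mulrN.
  by congr (_ * M _ _ - M _ _ * M _ _); exact/val_inj.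
pose A := mx2 (M ord_max ord_max) (- M ord0 ord_max)
              (- M ord_max ord0) (M ord0 ord0).
have MA : M *m A = 1%:M.
  apply/matrixP; elim/ord2P; elim/ord2P; rewrite mulmx2 !mxE /= -?ME; ring.
have iME : invmx (mxC M) = mxC A.
  have MCA : mxC M *m mxC A = 1%:M by rewrite -map_mxM MA map_mx1.
  have [uM _] := mulmx1_unit MCA.
  by rewrite -[invmx _]mulmx1 -MCA mulKmx.
have ReK (x : C) : Im x = 0 -> (Re x)%:C = x by case: x => a b /= ->.
have i2 : (2%:R : C)^-1 = (2%:R^-1)%:C by rewrite fmorphV rmorph_nat.
case: D => k l n m; rewrite /mobius /cplx; congr Cyc; apply: ReK;
  rewrite /= iME !mulmx2 !mxE /= ?i2; simpc => /=; ring.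
Qed.

End Cycles.

(* Main.v *)
Require Import Defs.
From HB Require Import structures.
From mathcomp Require Import all_boot all_order all_algebra.
From mathcomp Require Import complex.
From mathcomp Require Import all_classical all_reals all_analysis.
From mathcomp Require Import ring lra.

Set Implicit Arguments.
Unset Strict Implicit.
Unset Printing Implicit Defensive.

Import Order.TTheory GRing.Theory Num.Theory.
Import numFieldNormedType.Exports.

Local Open Scope classical_set_scope.
Local Open Scope ring_scope.
Local Open Scope complex_scope.

(** Why the proposition is true.

The cycles product is a quadratic form on 4-space for which Moebius
transformations are isometries.  A point s/t of the real line, infinity
included, is a null vector (t^2, s t, 0, s^2), and every null vector with n = 0
is of this form up to a scalar ([real_pointP]).

Invariance.  The product is the polarised determinant of the matrices of cycles
([cprod_det]), and SL_2(R) acts on these by similarity; so the product, the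
cross ratio and the distance are preserved.  The construction involves choices,
and [cross_ratio_unique] shows that they affect at most the sign of the
distance.  Either C1, C2 and the real line are linearly independent; then the
orthogonal cycle C is unique, and it has at most two intersection points with
the real line because these are the roots of a binary quadratic form.  Or they
are dependent; then every cross ratio in question equals 1.

Lobachevsky metric.  The product of the point z of the half-plane with the
boundary point s/t is |s - t z|^2, so that d(z1, z2) is the difference of the
values of f(z) = log |(z - a) / (z - b)| at z1 and z2, where a and b are the
ends of the geodesic C through z1 and z2.  The gradient of f has hyperbolic norm
at most 1 at every point of the half-plane ([potential_slope]), and integration
along a curve shows that no curve from z1 to z2 is shorter than
|f(z1) - f(z2)| ([length_ge_potential]).  The arc of C from z1 to z2, on which
(z - a) / (z - b) runs along the imaginary axis, attains this bound
([arc_length]).  Hence |d| is the infimum of the lengths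
([lobachevsky_potential]).

Additivity.  The cross ratios multiply ([cross_ratio_chain]), and the principal
logarithm turns this into a sum modulo 2 i pi ([Log_mul]).

Imaginary axis.  The products of a cycle with the points 0 and infinity are its
coordinates m and k, so the cross ratio is (m1/k1) / (m2/k2)
([cross_ratio_vertical]). *)

(** * Linear algebra of the cycles product *)

Section CycleAlgebra.
Variable F : numFieldType.
Implicit Types (a b s t : F) (C D X Y Z W : cyc F).

Lemma scale_cycA a b C : scale_cyc a (scale_cyc b C) = scale_cyc (a * b) C.
Proof. by rewrite /scale_cyc /= !mulrA. Qed.

Lemma scale_cyc1 C : scale_cyc 1 C = C.
Proof. by case: C => k l n m; rewrite /scale_cyc /= !mul1r. Qed.

Lemma same_cycle_refl C : same_cycle C C.
Proof. by exists 1; rewrite ?oner_neq0 ?scale_cyc1. Qed.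

Lemma same_cycle_sym C D : same_cycle C D -> same_cycle D C.
Proof.
by move=> [a a0 ->]; exists a^-1; rewrite ?invr_eq0 // scale_cycA mulVf //
  scale_cyc1.
Qed.

Lemma same_cycle_trans C D X :
  same_cycle C D -> same_cycle D X -> same_cycle C X.
Proof.
move=> [a a0 ->] [b b0 ->]; exists (b * a); first by rewrite mulf_neq0.
by rewrite scale_cycA.
Qed.

Lemma cprodC C D : cprod C D = cprod D C.
Proof. rewrite /cprod; ring. Qed.

Lemma cprod_scalel a C D : cprod (scale_cyc a C) D = a * cprod C D.
Proof. rewrite /cprod /=; ring. Qed.

Lemma cprod_scaler a C D : cprod C (scale_cyc a D) = a * cprod C D.
Proof. by rewrite cprodC cprod_scalel cprodC. Qed.

Lemma cprod_real_line C : cprod C (real_line F) = 2%:R * cn C.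
Proof. rewrite /cprod /=; ring. Qed.

Lemma orthogonal_real_line C : orthogonal_cyc C (real_line F) <-> cn C = 0.
Proof.
rewrite /orthogonal_cyc cprod_real_line; split=> [/eqP|->];
  last by rewrite mulr0.
by rewrite mulf_eq0 pnatr_eq0 /= => /eqP.
Qed.

Lemma nonzero_scale a C : a != 0 ->
  nonzero_cyc C -> nonzero_cyc (scale_cyc a C).
Proof.
case: C => k l n m a0 nzC [] /eqP + /eqP + /eqP + /eqP.
rewrite !mulf_eq0 (negPf a0) /= => /eqP k0 /eqP l0 /eqP n0 /eqP m0.
by apply: nzC; rewrite k0 l0 n0 m0.
Qed.

Lemma orthogonal_scale a b C D :
  orthogonal_cyc C D -> orthogonal_cyc (scale_cyc a C) (scale_cyc b D).
Proof.
by rewrite /orthogonal_cyc cprod_scalel cprod_scaler => ->; rewrite !mulr0.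
Qed.

Lemma orthogonal_same C D C' D' : same_cycle C C' -> same_cycle D D' ->
  orthogonal_cyc C D -> orthogonal_cyc C' D'.
Proof. by move=> [a _ ->] [b _ ->]; exact: orthogonal_scale. Qed.

(** The zero radius cycle of the point s/t of the real projective line, in
homogeneous coordinates so that infinity (t = 0) needs no separate treatment. *)
Definition real_point s t : cyc F := Cyc (t ^+ 2) (s * t) 0 (s ^+ 2).

(** On the plane n = 0 the form is 2 (k m - l^2), and its null cone k m = l^2 is
a conic, rationally parametrised by [real_point]. *)
Lemma real_pointP Z :
  nonzero_cyc Z -> orthogonal_cyc Z (real_line F) -> orthogonal_cyc Z Z ->
  exists s t, same_cycle (real_point s t) Z.
Proof.
case: Z => k l n m nzZ /orthogonal_real_line /= n0.
rewrite n0 /orthogonal_cyc /cprod /= in nzZ * => /eqP.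
have -> : k * m + k * m - 2%:R * l * l - 2%:R * 0 * 0 = 2%:R * (k * m - l ^+ 2).
  ring.
rewrite mulf_eq0 pnatr_eq0 /= subr_eq0 => /eqP kmE.
have [k0|k0] := eqVneq k 0.
  have l0 : l = 0.
    by apply/eqP; rewrite -sqrf_eq0 -kmE k0 mul0r.
  exists 1, 0, m; last by rewrite k0 l0 /scale_cyc /=; congr Cyc; ring.
  by apply/eqP => m0; apply: nzZ; rewrite k0 l0 m0.
exists (l / k), 1, k => //; rewrite /scale_cyc /=.
by congr Cyc; try ring; [field | rewrite -[m](mulKf k0) kmE; field].
Qed.

(** Orthogonality to the point s/t is a homogeneous quadratic equation in
(s, t). *)
Lemma cprod_real_point C s t :
  cprod C (real_point s t)
  = cm C * t ^+ 2 - 2%:R * cl C * s * t + ck C * s ^+ 2.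
Proof. rewrite /cprod /=; ring. Qed.

Lemma same_real_point s1 t1 s2 t2 :
  real_point s1 t1 <> Cyc 0 0 0 0 -> real_point s2 t2 <> Cyc 0 0 0 0 ->
  s1 * t2 = s2 * t1 -> same_cycle (real_point s1 t1) (real_point s2 t2).
Proof.
move=> nz1 nz2 E.
have [t10|t10] := eqVneq t1 0.
  have s10 : s1 != 0.
    by apply/eqP=> s10; apply: nz1; rewrite /real_point s10 t10 mul0r expr0n.
  have t20 : t2 = 0.
    by apply/eqP; rewrite -(inj_eq (mulfI s10)) E t10 !mulr0.
  have s20 : s2 != 0.
    by apply/eqP=> s20; apply: nz2; rewrite /real_point s20 t20 mul0r expr0n.
  exists ((s2 / s1) ^+ 2); first by rewrite expf_neq0 // mulf_neq0 // invr_eq0.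
  by rewrite /real_point /scale_cyc t10 t20 /=; congr Cyc; field.
have t20 : t2 != 0.
  apply/eqP=> t20; apply: nz2; rewrite /real_point t20.
  have -> : s2 = 0 by apply: (mulIf t10); rewrite -E t20 mulr0 mul0r.
  by rewrite mul0r expr0n.
exists ((t2 / t1) ^+ 2); first by rewrite expf_neq0 // mulf_neq0 // invr_eq0.
have -> : s2 = s1 * t2 / t1 by rewrite E mulfK.
by rewrite /real_point /scale_cyc /=; congr Cyc; field.
Qed.

Lemma nonzero_same C D : same_cycle C D -> nonzero_cyc C -> nonzero_cyc D.
Proof. by move=> [a a0 ->]; exact: nonzero_scale. Qed.

(** The cycles with n = 0 orthogonal to C and D are given by two linear
equations in (k, 2 l, m); this is the vector product of their coefficient
vectors.  It vanishes exactly when C, D and the real line are linearly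
dependent. *)
Definition joint_orthogonal C D : cyc F :=
  Cyc (ck C * cl D - ck D * cl C) ((ck C * cm D - ck D * cm C) / 2%:R) 0
      (cl C * cm D - cl D * cm C).

(** The difference of the two sides is bilinear in the vector product of C and D
and the vector product of X and Y. *)
Lemma cprod_swap_dependent C D X Y :
  joint_orthogonal C D = Cyc 0 0 0 0 -> cn X = 0 -> cn Y = 0 ->
  cprod C X * cprod D Y = cprod C Y * cprod D X.
Proof.
move=> [a0 b0 c0] X0 Y0; rewrite /cprod X0 Y0.
have {}b0 : ck C * cm D - ck D * cm C = 0.
  by move/eqP: b0; rewrite mulf_eq0 invr_eq0 pnatr_eq0 orbF => /eqP.
apply/eqP; rewrite -subr_eq0; apply/eqP.
set a := _ - _ in a0; set b := _ - _ in b0; set c := _ - _ in c0.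
transitivity (b * (cm X * ck Y - cm Y * ck X)
  - 2%:R * a * (cm X * cl Y - cm Y * cl X)
  + 2%:R * c * (ck X * cl Y - ck Y * cl X)).
  by rewrite /a /b /c; ring.
by rewrite a0 b0 c0; ring.
Qed.

Lemma joint_orthogonal_unique C D X :
  joint_orthogonal C D <> Cyc 0 0 0 0 -> nonzero_cyc X -> cn X = 0 ->
  orthogonal_cyc X C -> orthogonal_cyc X D ->
  same_cycle (joint_orthogonal C D) X.
Proof.
case: X => k l n m; rewrite /orthogonal_cyc /joint_orthogonal /cprod /=.
set a := ck C * cl D - _; set b := ck C * cm D - _; set c := cl C * cm D - _.
move=> nzJ nzX n0; rewrite n0 in nzX *.
rewrite !(mulr0, mul0r, subr0) => oC oD.
(* Each minor of (k, 2 l, m) against (a, b, c) is a combination of the two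
   orthogonality relations. *)
have ab : k * b - 2%:R * l * a = 0.
  rewrite /a /b -[RHS](subrr 0) -{1}(mulr0 (ck C)) -{1}oD -(mulr0 (ck D)) -oC.
  by ring.
have ac : k * c - m * a = 0.
  rewrite /a /c -[RHS](subrr 0) -{1}(mulr0 (cl C)) -{1}oD -(mulr0 (cl D)) -oC.
  by ring.
have bc : 2%:R * l * c - m * b = 0.
  rewrite /b /c -[RHS](subrr 0) -{1}(mulr0 (cm C)) -{1}oD -(mulr0 (cm D)) -oC.
  by ring.
clearbody a b c.
move: ab ac bc => /eqP; rewrite subr_eq0 => /eqP ab /eqP; rewrite subr_eq0.
move=> /eqP ac /eqP; rewrite subr_eq0 => /eqP bc.
have [x [kE lE mE]] :
    exists x, [/\ k = x * a, l = x * (b / 2%:R) & m = x * c].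
  have [a0|a0] := eqVneq a 0; last first.
    exists (k / a); split; first by rewrite divfK.
      by rewrite mulf_div ab; field.
    by rewrite mulrAC ac mulfK.
  have [b0|b0] := eqVneq b 0; last first.
    exists (2%:R * l / b); split; last by rewrite mulrAC bc mulfK.
      by apply: (mulIf b0); rewrite ab a0; ring.
    by field.
  have [c0|c0] := eqVneq c 0; first by case: nzJ; rewrite a0 b0 c0 mul0r.
  exists (m / c); split; last by rewrite divfK.
    by apply: (mulIf c0); rewrite ac a0; ring.
  have := bc; rewrite b0 mulr0 => /eqP.
  rewrite !mulf_eq0 pnatr_eq0 (negPf c0) orbF /= => /eqP ->.
  by rewrite mul0r mulr0.
exists x; last by rewrite /scale_cyc /= mulr0 kE lE mE.
apply/eqP=> x0; apply: nzX.
by rewrite kE lE mE x0 !mul0r.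
Qed.


End CycleAlgebra.

(** * Cross ratio and uniqueness of the construction *)

Section CrossRatio.
Variable R : realType.
Local Notation C := R[i].

Lemma cplx_inj : injective (@cplx R).
Proof. by move=> [k l n m] [k' l' n' m'] [-> -> -> ->]. Qed.

Lemma cplx_scale (a : R) D : cplx (scale_cyc a D) = scale_cyc a%:C (cplx D).
Proof. by rewrite /cplx /scale_cyc /= !rmorphM. Qed.

Lemma nonzero_cplx (D : cyc R) : nonzero_cyc D -> nonzero_cyc (cplx D).
Proof.
move=> nzD.
by rewrite /nonzero_cyc -[Cyc 0 _ _ _]/(cplx (Cyc 0 0 0 0)) => /cplx_inj.
Qed.

Lemma same_cycle_cplx (D D' : cyc R) :
  same_cycle D D' -> same_cycle (cplx D) (cplx D').
Proof.
move=> [a a0 ->]; exists a%:C; last exact: cplx_scale.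
by rewrite fmorph_eq0.
Qed.

Lemma cprod_cplx (D D' : cyc R) : cprod (cplx D) (cplx D') = (cprod D D')%:C.
Proof. by rewrite /cprod /= !(rmorphB, rmorphD, rmorphM, rmorph_nat). Qed.

Lemma orthogonal_cplx (D D' : cyc R) :
  orthogonal_cyc (cplx D) (cplx D') <-> orthogonal_cyc D D'.
Proof.
by rewrite /orthogonal_cyc cprod_cplx; split=> [[]|->].
Qed.

Lemma cplx_real_line : cplx (real_line R) = real_line C.
Proof. by rewrite /cplx /real_line /= rmorphN rmorph1. Qed.

Implicit Types X Y Z W : cyc C.

Lemma cross_ratio_swap X Y Z W :
  cross_ratio X Y W Z = (cross_ratio X Y Z W)^-1.
Proof. by rewrite /cross_ratio [RHS]invf_div -[in RHS](invf_div (cprod X W))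
  -[in RHS](invf_div (cprod Y W)) invrK mulrC. Qed.

Lemma cross_ratio_chain X1 X2 X3 Z W : cprod X2 Z != 0 -> cprod X2 W != 0 ->
  cross_ratio X1 X2 Z W * cross_ratio X2 X3 Z W = cross_ratio X1 X3 Z W.
Proof.
by move=> z w; rewrite /cross_ratio mulrA divfK // mulf_neq0 ?invr_eq0.
Qed.

(** In each fraction of the cross ratio the scalars of its two entries cancel,
so the cross ratio is a function of points of projective space. *)
Lemma cross_ratio_same X X' Y Y' Z Z' W W' :
  same_cycle X X' -> same_cycle Y Y' -> same_cycle Z Z' -> same_cycle W W' ->
  cross_ratio X' Y' Z' W' = cross_ratio X Y Z W.
Proof.
have cancel_scale (a x y : C) : a != 0 -> a * x / (a * y) = x / y.
  by move=> a0; rewrite invfM mulrACA divff // mul1r.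
have left (a b : C) A B V U : a != 0 -> b != 0 ->
    cross_ratio (scale_cyc a A) (scale_cyc b B) V U = cross_ratio A B V U.
  move=> a0 b0; rewrite /cross_ratio !cprod_scalel.
  by rewrite !cancel_scale.
have right (a : C) A B V U : a != 0 ->
    cross_ratio A B (scale_cyc a V) U = cross_ratio A B V U.
  move=> a0; rewrite /cross_ratio !cprod_scaler.
  by rewrite -(mulrA a (cprod A V)) -(mulrA a (cprod B V)) cancel_scale.
move=> [a a0 ->] [b b0 ->] [c c0 ->] [d d0 ->]; rewrite left // right //.
by rewrite cross_ratio_swap right // -cross_ratio_swap.
Qed.

(** In homogeneous coordinates of the real projective line the intersection
points are the roots of a non-zero binary quadratic form.  Two independent
roots (s1, t1) and (s2, t2) determine the form up to a scalar, as
(s1 t - s t1) (s2 t - s t2), whence a third root is proportional to one of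
them. *)
Lemma at_most_two_intersections (D : cyc R) Z1 Z2 W :
  nonzero_cyc D -> orthogonal_cyc D (real_line R) ->
  intersection_point D Z1 -> intersection_point D Z2 -> ~ same_cycle Z1 Z2 ->
  intersection_point D W -> same_cycle Z1 W \/ same_cycle Z2 W.
Proof.
move=> /nonzero_cplx nzD /orthogonal_cplx; rewrite cplx_real_line.
rewrite /intersection_point; move: (cplx D) nzD => {}D nzD.
move=> /orthogonal_real_line Dn.
move=> [nz1 o1 r1 n1] [nz2 o2 r2 n2] ns12 [nzW oW rW nW].
have [s1 [t1 E1]] := real_pointP nz1 r1 n1.
have [s2 [t2 E2]] := real_pointP nz2 r2 n2.
have [s [t E]] := real_pointP nzW rW nW.
have root p q Z : same_cycle (real_point p q) Z -> orthogonal_cyc Z D ->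
    cm D * q ^+ 2 - 2%:R * cl D * p * q + ck D * p ^+ 2 = 0.
  move=> /same_cycle_sym[a a0 EZ] oZ; rewrite -cprod_real_point EZ cprodC.
  by rewrite cprod_scalel oZ mulr0.
have nz p q Z : same_cycle (real_point p q) Z -> nonzero_cyc Z ->
    real_point p q <> Cyc 0 0 0 0.
  by move=> /same_cycle_sym; exact: nonzero_same.
have [R1 R2 R0] : [/\
   cm D * t1 ^+ 2 - 2%:R * cl D * s1 * t1 + ck D * s1 ^+ 2 = 0,
   cm D * t2 ^+ 2 - 2%:R * cl D * s2 * t2 + ck D * s2 ^+ 2 = 0 &
   cm D * t ^+ 2 - 2%:R * cl D * s * t + ck D * s ^+ 2 = 0].
  by split; [exact: root E1 o1 | exact: root E2 o2 | exact: root E oW].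
have d0 : s1 * t2 - s2 * t1 != 0.
  apply/eqP => /eqP; rewrite subr_eq0 => /eqP d0; apply: ns12.
  apply: (same_cycle_trans (same_cycle_sym E1)); apply: (same_cycle_trans _ E2).
  exact: same_real_point (nz _ _ _ E1 nz1) (nz _ _ _ E2 nz2) d0.
set p := (s1 * t - s * t1) * (s2 * t - s * t2).
(* Eliminating one coefficient at a time from the first two equations shows
   that k, -2 l, m are proportional to t1 t2, -(s1 t2 + s2 t1), s1 s2. *)
have kl : ck D * (s1 * t2 + s2 * t1) - 2%:R * cl D * (t1 * t2) = 0.
  apply: (mulfI d0); rewrite mulr0 -[RHS](subrr 0) -{1}(mulr0 (t2 ^+ 2)).
  by rewrite -{1}R1 -(mulr0 (t1 ^+ 2)) -R2; ring.
have ml : cm D * (s1 * t2 + s2 * t1) - 2%:R * cl D * (s1 * s2) = 0.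
  apply: (mulfI d0); rewrite mulr0 -[RHS](subrr 0) -{1}(mulr0 (s1 ^+ 2)).
  by rewrite -{1}R2 -(mulr0 (s2 ^+ 2)) -R1; ring.
have km : cm D * (t1 * t2) - ck D * (s1 * s2) = 0.
  apply: (mulfI d0); rewrite mulr0 -[RHS](subrr 0) -{1}(mulr0 (s1 * t1)).
  by rewrite -{1}R2 -(mulr0 (s2 * t2)) -R1; ring.
have p0 : p = 0.
  have kp : ck D * p = 0.
    have -> : ck D * p = t1 * t2 * 0 - s * t * 0 - t ^+ 2 * 0.
      by rewrite -{1}R0 -{1}kl -km /p; ring.
    by rewrite !mulr0 !subr0.
  have lp : 2%:R * cl D * p = 0.
    have -> : 2%:R * cl D * p
        = (s1 * t2 + s2 * t1) * 0 - s ^+ 2 * 0 - t ^+ 2 * 0.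
      by rewrite -{1}R0 -{1}kl -ml /p; ring.
    by rewrite !mulr0 !subr0.
  have mp : cm D * p = 0.
    have -> : cm D * p = s1 * s2 * 0 - s * t * 0 + s ^+ 2 * 0.
      by rewrite -{1}R0 -{1}ml -km /p; ring.
    by rewrite !mulr0 subr0 addr0.
  clearbody p; apply/eqP; apply: contraT => pn0; exfalso; apply: nzD.
  case: D Dn {o1 o2 oW root kl ml km R1 R2 R0} kp lp mp => k l n m /= ->.
  move=> /eqP; rewrite mulf_eq0 (negPf pn0) orbF => /eqP ->.
  move=> /eqP; rewrite !mulf_eq0 (negPf pn0) orbF pnatr_eq0 /= => /eqP ->.
  by move=> /eqP; rewrite mulf_eq0 (negPf pn0) orbF => /eqP ->.
move/eqP: p0; rewrite mulf_eq0 !subr_eq0 => /orP[]/eqP d; [left|right].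
  apply: (same_cycle_trans (same_cycle_sym E1)); apply: (same_cycle_trans _ E).
  exact: same_real_point (nz _ _ _ E1 nz1) (nz _ _ _ E nzW) d.
apply: (same_cycle_trans (same_cycle_sym E2)); apply: (same_cycle_trans _ E).
exact: same_real_point (nz _ _ _ E2 nz2) (nz _ _ _ E nzW) d.
Qed.
Lemma associated_same (C1 C2 D C1' C2' : cyc R) Z1 Z2 :
  same_cycle C1 C1' -> same_cycle C2 C2' ->
  associated C1 C2 D Z1 Z2 -> associated C1' C2' D Z1 Z2.
Proof.
move=> s1 s2 [[nz1 nz2 s12 r1 r2] [nzD oD1 oD2 oDr] iZ [n11 n12 n21 n22]].
have [t1 t2] := (same_cycle_sym s1, same_cycle_sym s2).
have prod0 (A B : cyc R) Z : same_cycle A B -> cprod (cplx A) Z != 0 ->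
    cprod (cplx B) Z != 0.
  move=> /same_cycle_cplx[a a0 ->] nz; rewrite cprod_scalel.
  by rewrite mulf_neq0.
have oD A B : same_cycle A B -> orthogonal_cyc D A -> orthogonal_cyc D B.
  by move=> sAB; apply: orthogonal_same sAB; exact: same_cycle_refl.
split=> //.
- split; [exact: nonzero_same s1 nz1 | exact: nonzero_same s2 nz2 | | |].
  + by move=> s; apply/s12/(same_cycle_trans s1)/(same_cycle_trans s).
  + by move=> s; exact/r1/(same_cycle_trans s1).
  + by move=> s; exact/r2/(same_cycle_trans s2).
- by split=> //; [exact: oD s1 _ | exact: oD s2 _].
- split; [exact: prod0 n11 | exact: prod0 n12 | | exact: prod0 n22].
  exact: prod0 n21.
Qed.

(** The construction of the distance involves the choice of a cycle D and of an
order of its two intersection points; only the latter matters.  If C1, C2 and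
the real line are independent, then D is unique up to a scalar and its
intersection points are unique up to order.  Otherwise C1 and C2 have
proportional products with all points of the real line, and both cross
ratios equal 1. *)
Lemma cross_ratio_unique (C1 C2 D D' : cyc R) Z1 Z2 W1 W2 :
  associated C1 C2 D Z1 Z2 -> associated C1 C2 D' W1 W2 ->
  let r := cross_ratio (cplx C1) (cplx C2) in
  r W1 W2 = r Z1 Z2 \/ r W1 W2 = r Z2 Z1.
Proof.
move=> [_ [nzD oD1 oD2 oDr] [iZ1 iZ2 nsZ] [nz11 nz12 nz21 nz22]].
move=> [_ [nzD' oD1' oD2' oDr'] [iW1 iW2 nsW] [nw11 nw12 nw21 nw22]] r.
have same Z W Z' W' : same_cycle Z W -> same_cycle Z' W' -> r W W' = r Z Z'.
  by move=> ? ?; apply: cross_ratio_same => //; exact: same_cycle_refl.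
have cn0 (Y : cyc R) Z : intersection_point Y Z -> cn Z = 0.
  by move=> [_ _ /orthogonal_real_line].
have [J0|J0] := pselect (joint_orthogonal C1 C2 = Cyc 0 0 0 0).
  have JC : joint_orthogonal (cplx C1) (cplx C2) = Cyc 0 0 0 0.
    rewrite -[RHS]/(cplx (Cyc 0 0 0 0)) -J0 /joint_orthogonal /cplx /=.
    by rewrite fmorph_div !rmorphB !rmorphM !rmorph_nat.
  have one (Y Y' : cyc R) Z Z' :
      intersection_point Y Z -> intersection_point Y' Z' ->
      cprod (cplx C1) Z' != 0 -> cprod (cplx C2) Z != 0 ->
      cprod (cplx C2) Z' != 0 -> r Z Z' = 1.
    move=> /cn0 Z0 /cn0 Z0' n1 n2 n2'.
    rewrite /r /cross_ratio invf_div mulf_div.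
    by rewrite (cprod_swap_dependent JC Z0 Z0') divff // mulf_neq0.
  by left; rewrite (one _ _ _ _ iZ1 iZ2) // (one _ _ _ _ iW1 iW2).
have sD : same_cycle D D'.
  have J (X : cyc R) :
      nonzero_cyc X -> orthogonal_cyc X C1 -> orthogonal_cyc X C2 ->
      orthogonal_cyc X (real_line R) -> same_cycle (joint_orthogonal C1 C2) X.
    by move=> nzX ? ? /orthogonal_real_line ?; exact: joint_orthogonal_unique.
  exact/(same_cycle_trans (same_cycle_sym (J D _ _ _ _)))/J.
have onD W : intersection_point D' W -> intersection_point D W.
  move=> [nzW oW rW nW]; split=> //; apply: orthogonal_same oW.
    exact: same_cycle_refl.
  exact/same_cycle_cplx/same_cycle_sym.
have meet W := at_most_two_intersections nzD oDr iZ1 iZ2 nsZ \o onD W.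
have nsW' Z : same_cycle Z W1 -> same_cycle Z W2 -> False.
  by move=> /same_cycle_sym s1 s2; exact/nsW/(same_cycle_trans s1).
have [s1|s1] := meet _ iW1; have [s2|s2] := meet _ iW2.
- by case: (nsW' _ s1 s2).
- by left; exact: same.
- by right; exact: same.
- by case: (nsW' _ s1 s2).
Qed.

End CrossRatio.

(** * Moebius transformations *)

Section Mobius.
Variable R : realType.
Local Notation C := R[i].
Implicit Types (M N : 'M[R]_2) (X Y Z : cyc C) (A B D : cyc R).

Lemma conj_mxC M : map_mx conjc (mxC M) = mxC M.
Proof. by apply/matrixP => i j; rewrite !mxE /=; simpc. Qed.

Lemma cyc_mxK : cancel (@cyc_mx R) (@mx_cyc R).
Proof.
case=> k l n m; have n2 : (2%:R : C) != 0 by rewrite pnatr_eq0.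
rewrite /mx_cyc /cyc_mx !mxE /= !opprK; congr Cyc; apply: (mulIf n2).
  by rewrite divfK //; ring.
rewrite divfK //; set i := 0 +i* 1.
by transitivity (- (i * i) * n * 2%:R); [ring | rewrite imagM opprK mul1r].
Qed.

Lemma det_mx2 (T : comNzRingType) (A : 'M[T]_2) :
  \det A = A ord0 ord0 * A ord_max ord_max - A ord0 ord_max * A ord_max ord0.
Proof.
rewrite (expand_det_row _ ord0) big_ord_recl big_ord1 /cofactor.
rewrite !det_mx11 !mxE /= !expr0 expr1 mul1r mulN1r mulrN.
by congr (_ * A _ _ - A _ _ * A _ _); exact/val_inj.
Qed.

(** The determinant of [cyc_mx X] is k m - l^2 - n^2, so that the product is its
polarisation; conjugating the matrices leaves it unchanged. *)
Lemma cprod_det X Y : cprod X Y =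
  \det (cyc_mx X + cyc_mx Y) - \det (cyc_mx X) - \det (cyc_mx Y).
Proof.
rewrite !det_mx2.
rewrite /cyc_mx !mxE /= /cprod.
transitivity (ck X * cm Y + ck Y * cm X - 2%:R * cl X * cl Y
  + (-1) * (2%:R * cn X * cn Y)); first by ring.
rewrite -(imagM R); ring.
Qed.

Lemma unit_mxC M : \det M = 1 -> mxC M \in unitmx.
Proof. by move=> d; rewrite unitmxE det_map_mx d rmorph1 unitr1. Qed.

(** The conjugation in the action is invisible for a real matrix: cycles are
transformed by similarity. *)
Lemma cyc_mx_mobius M X :
  cyc_mx (mobiusC M X) = mxC M *m cyc_mx X *m invmx (mxC M).
Proof. by rewrite cyc_mx_mobiusC conj_mxC. Qed.

Lemma cprod_mobiusC M X Y : \det M = 1 ->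
  cprod (mobiusC M X) (mobiusC M Y) = cprod X Y.
Proof.
move=> /unit_mxC uM.
have dJ E : \det (mxC M *m E *m invmx (mxC M)) = \det E.
  by rewrite !det_mulmx mulrAC -det_mulmx mulmxV // det1 mul1r.
have polar (P Q A B : 'M[C]_2) : P = mxC M *m A *m invmx (mxC M) ->
    Q = mxC M *m B *m invmx (mxC M) ->
    \det (P + Q) - \det P - \det Q = \det (A + B) - \det A - \det B.
  by move=> -> ->; rewrite -mulmxDl -mulmxDr; congr (_ - _ - _); exact: dJ.
by rewrite [LHS]cprod_det [RHS]cprod_det; apply: polar; exact: cyc_mx_mobius.
Qed.

Lemma mobiusC_scale M (a : C) X :
  mobiusC M (scale_cyc a X) = scale_cyc a (mobiusC M X).
Proof.
have mxZ Y : cyc_mx (scale_cyc a Y) = a *: cyc_mx Y.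
  by apply/matrixP; elim/ord2P; elim/ord2P; rewrite !mxE /=; ring.
apply: (can_inj cyc_mxK).
by rewrite cyc_mx_mobius !mxZ cyc_mx_mobius -scalemxAr -scalemxAl.
Qed.

Lemma mobiusCK M : \det M = 1 -> cancel (mobiusC M) (mobiusC (invmx M)).
Proof.
move=> dM X; apply: (can_inj cyc_mxK); rewrite !cyc_mx_mobius.
have -> : mxC (invmx M) = invmx (mxC M) by exact: map_invmx.
by rewrite invmxK !mulmxA mulVmx ?unit_mxC // mul1mx -mulmxA mulVmx
  ?unit_mxC // mulmx1.
Qed.

(** The matrix of the real line is scalar, hence commutes with everything. *)
Lemma mobiusC_real_line M : \det M = 1 -> mobiusC M (real_line C) = real_line C.
Proof.
move=> dM; apply: (can_inj cyc_mxK); rewrite cyc_mx_mobius -cplx_real_line.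
by rewrite cyc_mx_real_line scalar_mxC mulmxK // unit_mxC.
Qed.

Lemma mobius_real_line M : \det M = 1 -> mobius M (real_line R) = real_line R.
Proof.
move=> dM; apply: cplx_inj.
by rewrite cplx_mobius // cplx_real_line mobiusC_real_line.
Qed.

Lemma cprod_mobius M A B : \det M = 1 ->
  cprod (mobius M A) (mobius M B) = cprod A B.
Proof.
move=> dM; apply: complexI.
have iso X Y (U V : cyc C) : X = mobiusC M U -> Y = mobiusC M V ->
  cprod X Y = cprod U V by move=> -> ->; exact: cprod_mobiusC.
by rewrite -2!cprod_cplx; apply: iso; exact: cplx_mobius.
Qed.

Lemma same_cycle_mobiusC M X Y : \det M = 1 ->
  same_cycle (mobiusC M X) (mobiusC M Y) -> same_cycle X Y.
Proof.
move=> dM [a a0]; rewrite -mobiusC_scale => /(can_inj (mobiusCK dM)) ->.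
by exists a.
Qed.

Lemma same_cycle_mobius M A B : \det M = 1 ->
  same_cycle (mobius M A) (mobius M B) -> same_cycle A B.
Proof.
move=> dM [a a0 e]; exists a => //; apply: cplx_inj; rewrite cplx_scale.
apply: (can_inj (mobiusCK dM)).
by rewrite mobiusC_scale -!cplx_mobius // e cplx_scale.
Qed.

Lemma nonzero_mobiusC M X : \det M = 1 -> nonzero_cyc X ->
  nonzero_cyc (mobiusC M X).
Proof.
move=> dM nzX M0; apply: nzX; apply: (can_inj (mobiusCK dM)).
have zero : Cyc 0 0 0 0 = scale_cyc 0 (Cyc 0 0 0 0) :> cyc C.
  by rewrite /scale_cyc /= mul0r.
by rewrite M0 zero mobiusC_scale /scale_cyc !mul0r.
Qed.

Lemma nonzero_mobius M A : \det M = 1 -> nonzero_cyc A ->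
  nonzero_cyc (mobius M A).
Proof.
move=> dM /nonzero_cplx /(nonzero_mobiusC dM) + M0; apply.
by rewrite -cplx_mobius // M0.
Qed.

Lemma cross_ratio_mobius M A B Z1 Z2 : \det M = 1 ->
  cross_ratio (cplx (mobius M A)) (cplx (mobius M B))
              (mobiusC M Z1) (mobiusC M Z2)
  = cross_ratio (cplx A) (cplx B) Z1 Z2.
Proof.
move=> dM.
have iso (f : cyc C -> cyc C) X Y U V : X = f U -> Y = f V ->
    (forall X Y, cprod (f X) (f Y) = cprod X Y) ->
    cross_ratio X Y (f Z1) (f Z2) = cross_ratio U V Z1 Z2.
  by move=> -> -> fP; rewrite /cross_ratio 4!fP.
by apply: iso => [||X Y]; [exact: cplx_mobius..|exact: cprod_mobiusC].
Qed.

Lemma associated_mobius M A B D Z1 Z2 : \det M = 1 ->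
  associated A B D Z1 Z2 ->
  associated (mobius M A) (mobius M B) (mobius M D)
             (mobiusC M Z1) (mobiusC M Z2).
Proof.
move=> dM [[nz1 nz2 s12 r1 r2] [nzD oD1 oD2 oDr] [iZ1 iZ2 ns]].
move=> [n11 n12 n21 n22].
have notline E : ~ same_cycle E (real_line R) ->
    ~ same_cycle (mobius M E) (real_line R).
  by rewrite -{2}(mobius_real_line dM) => nE /(same_cycle_mobius dM).
have iM Z : intersection_point D Z ->
    intersection_point (mobius M D) (mobiusC M Z).
  move=> [nzZ oZ rZ nZ]; split.
  - exact: nonzero_mobiusC.
  - by rewrite /orthogonal_cyc cplx_mobius // cprod_mobiusC.
  - by rewrite /orthogonal_cyc -(mobiusC_real_line dM) cprod_mobiusC.
  - by rewrite /orthogonal_cyc cprod_mobiusC.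
split.
- split; try exact: nonzero_mobius; try exact: notline.
  by move=> /(same_cycle_mobius dM).
- split; first exact: nonzero_mobius.
  + by rewrite /orthogonal_cyc cprod_mobius.
  + by rewrite /orthogonal_cyc cprod_mobius.
  + by rewrite /orthogonal_cyc -(mobius_real_line dM) cprod_mobius.
- by split; [exact: iM | exact: iM | move=> /(same_cycle_mobiusC dM)].
- by split; rewrite cplx_mobius // cprod_mobiusC.
Qed.

End Mobius.

(** * The principal logarithm *)

Section Logarithm.
Variable R : realType.
Local Notation C := R[i].
Implicit Types (x y t : R) (z w : C).

Lemma normc_gt0 z : z != 0 -> 0 < Normc.normc z.
Proof.
move=> z0; have : 0 <= Normc.normc z by case: z {z0} => a b; exact: sqrtr_ge0.
rewrite le_eqVlt => /orP[/eqP/esym/Normc.eq0_normc z0'|//].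
by rewrite z0' eqxx in z0.
Qed.

Lemma normc_sqr z : Normc.normc z ^+ 2 = complex.Re z ^+ 2 + complex.Im z ^+ 2.
Proof. by case: z => a b /=; rewrite sqr_sqrtr // addr_ge0 ?sqr_ge0. Qed.

Lemma Re_normc_bound z : z != 0 -> -1 <= complex.Re z / Normc.normc z <= 1.
Proof.
move=> /normc_gt0 r0; rewrite -ler_norml normrM normfV (gtr0_norm r0).
rewrite ler_pdivrMr // mul1r -(@ler_pXn2r _ 2) ?nnegrE ?normr_ge0 ?(ltW r0) //.
by rewrite real_normK ?num_real // normc_sqr lerDl sqr_ge0.
Qed.

Lemma sin_acos_Re z : z != 0 ->
  sin (acos (complex.Re z / Normc.normc z)) = `|complex.Im z| / Normc.normc z.
Proof.
move=> z0; have r0 := normc_gt0 z0; rewrite sin_acos ?Re_normc_bound //.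
have -> : 1 - (complex.Re z / Normc.normc z) ^+ 2
    = (complex.Im z / Normc.normc z) ^+ 2.
  rewrite !expr_div_n -[X in X - _](@divff _ (Normc.normc z ^+ 2)).
    by rewrite {1}normc_sqr -mulrBl addrC addKr.
  by rewrite expf_neq0 // gt_eqF.
by rewrite sqrtr_sqr normrM normfV (gtr0_norm r0).
Qed.

Lemma Arg_polar z : z != 0 ->
  cos (Arg z) = complex.Re z / Normc.normc z /\
  sin (Arg z) = complex.Im z / Normc.normc z.
Proof.
move=> z0; have bnd := Re_normc_bound z0; have sE := sin_acos_Re z0.
rewrite /Arg; case: ifPn => b0.
  by rewrite acosK ?in_itv //= sE ger0_norm.
rewrite cosN sinN acosK ?in_itv //= sE ltr0_norm ?ltNge //.
by rewrite mulNr opprK.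
Qed.

Lemma Arg_bound z : z != 0 -> - pi < Arg z <= pi.
Proof.
move=> z0; have bnd := Re_normc_bound z0; have sE := sin_acos_Re z0.
have [p0 t0 tpi] := And3 (pi_gt0 R) (acos_ge0 bnd) (acos_lepi bnd).
rewrite /Arg; case: ifPn => b0.
  by rewrite tpi (lt_le_trans _ t0) // oppr_lt0.
rewrite ltrN2 lt_neqAle tpi andbT (le_trans _ (ltW p0)) ?oppr_le0 // andbT.
apply/eqP => tE; move/eqP: sE; rewrite tE sinpi eq_sym mulf_eq0 invr_eq0.
by rewrite normr_eq0 (gt_eqF (normc_gt0 z0)) orbF lt_eqF // ltNge.
Qed.

(** The range is that of Arg (z w) - Arg z - Arg w, so a shift by at most one
period reduces to the injectivity of cos on [0, pi]. *)
Lemma cos_eq1 t : `|t| < pi *+ 3 -> cos t = 1 ->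
  exists j : int, t = j%:~R * (pi *+ 2).
Proof.
have small s : `|s| <= pi -> cos s = 1 -> s = 0.
  move=> spi c1; apply/normr0_eq0/cos_inj;
    rewrite ?in_itv /= ?normr_ge0 ?lexx //.
    exact: pi_ge0.
  by rewrite cos_norm cos0.
rewrite ltr_norml => /andP[lo hi] c1.
have [tpi|tpi] := lerP `|t| pi.
  by exists 0; rewrite mul0r; exact: small.
have [t0|t0] := lerP 0 t.
  exists 1; rewrite mul1r; apply/eqP; rewrite -subr_eq0; apply/eqP/small.
    rewrite ger0_norm // in tpi; rewrite ler_norml; apply/andP; split; lra.
  by rewrite -(cosD2pi (t - _)) subrK.
exists (- 1); rewrite mulN1r; apply/eqP; rewrite -addr_eq0; apply/eqP/small.
  rewrite ltr0_norm // in tpi; rewrite ler_norml; apply/andP; split; lra.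
by rewrite cosD2pi.
Qed.

(** Both sides have the real part ln |z w|, and their imaginary parts have the
same cosine and sine. *)
Lemma Log_mul z w : z != 0 -> w != 0 ->
  exists j : int,
    Log (z * w) = Log z + Log w + (j%:~R * (pi *+ 2))%:C * (0 +i* 1).
Proof.
move=> z0 w0; have zw0 : z * w != 0 by rewrite mulf_neq0.
have [/andP[zl zh] /andP[wl wh] /andP[pl ph]] :=
  And3 (Arg_bound z0) (Arg_bound w0) (Arg_bound zw0).
have [cz sz] := Arg_polar z0; have [cw sw] := Arg_polar w0.
have [cp sp] := Arg_polar zw0.
have [nz nw] := (normc_gt0 z0, normc_gt0 w0).
have [j jE] : exists j : int, Arg (z * w) - (Arg z + Arg w) = j%:~R * (pi *+ 2).
  apply: cos_eq1; first by rewrite ltr_norml; apply/andP; split; lra.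
  rewrite cosB cosD sinD cp sp cz sz cw sw Normc.normcM.
  have := normc_sqr z; have := normc_sqr w.
  case: z w {z0 w0 zw0 zl zh wl wh pl ph cz sz cw sw cp sp} nz nw
    => a b [c d]; move: (Normc.normc _) (Normc.normc _) => r s r0 s0 /= sE rE.
  rewrite !mulf_div -mulrBl -mulrDl !mulf_div -mulrDl.
  apply: (canLR (mulfK _)); first by rewrite !mulf_neq0 ?gt_eqF.
  transitivity (r ^+ 2 * s ^+ 2); last by ring.
  by rewrite rE sE; ring.
exists j; rewrite -jE /Log Normc.normcM lnM ?posrE //.
by apply/eqP; rewrite eq_complex /=; apply/andP; split; apply/eqP; ring.
Qed.

Lemma Log_pos x : 0 < x -> Log x%:C = (ln x)%:C.
Proof.
move=> x0; rewrite /Log /Arg /= lexx expr0n /= addr0 sqrtr_sqr gtr0_norm //.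
by rewrite divff ?gt_eqF // acos1.
Qed.

Lemma gt0_complexP z : 0 < z -> exists2 x, 0 < x & z = x%:C.
Proof. by case: z => a b; rewrite ltcE /= => /andP[/eqP -> a0]; exists a. Qed.

(** Halving the logarithm turns the ambiguity 2 i pi into i pi. *)
Lemma eqmod_ipi_half z w u :
  (exists j : int, z = w + u + (j%:~R * (pi *+ 2))%:C * (0 +i* 1)) ->
  eqmod_ipi (z / 2%:R) ((w + u) / 2%:R).
Proof.
move=> [j ->]; exists j.
have -> : (j%:~R * (pi *+ 2))%:C = 2%:R * j%:~R * (pi : R)%:C.
  by rewrite rmorphM rmorphMn rmorph_int -mulr_natr; ring.
by field.
Qed.

End Logarithm.

(** * Lower bound for hyperbolic lengths *)

Section HalfPlane.
Variable R : realType.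
Implicit Types (s t x y u : R).

Lemma det_gt0_neq0 s1 t1 s2 t2 : 0 < s1 * t2 - s2 * t1 ->
  (s1 != 0) || (t1 != 0) /\ (s2 != 0) || (t2 != 0).
Proof.
move=> d0; rewrite -!negb_and; split;
  apply: contraTN d0 => /andP[/eqP-> /eqP->];
  by rewrite mul0r mulr0 subrr ltxx.
Qed.

(** The squared modulus |s - t z|^2 for z = x + i y: a multiple of the squared
distance of z to the boundary point s/t, and a constant when t = 0 and this
point is infinity. *)
Definition gap s t x y : R := (s - t * x) ^+ 2 + (t * y) ^+ 2.

(** The function log |(s1 - t1 z) / (s2 - t2 z)|.  With a = s1/t1 and b = s2/t2
it is, up to a constant, log |(z - a) / (z - b)|, whose restriction to the
geodesic from a to b is a signed hyperbolic arc length. *)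
Definition potential s1 t1 s2 t2 x y : R :=
  (ln (gap s1 t1 x y) - ln (gap s2 t2 x y)) / 2%:R.

Lemma gap_gt0 s t x y : (s != 0) || (t != 0) -> 0 < y -> 0 < gap s t x y.
Proof.
move=> + y0; rewrite /gap; have [->|t0 _] := eqVneq t 0.
  rewrite orbF !mul0r subr0 expr0n addr0 => st.
  by rewrite exprn_even_gt0.
apply: ltr_wpDl; first exact: sqr_ge0.
by rewrite exprn_even_gt0 //= mulf_neq0 // gt_eqF.
Qed.

Lemma is_derive_gap s t (x y : R -> R) u (dx dy : R) :
  is_derive u 1 x dx -> is_derive u 1 y dy ->
  is_derive u 1 (fun v => gap s t (x v) (y v))
    (2%:R * (t ^+ 2 * y u * dy - t * (s - t * x u) * dx)).
Proof.
move=> Dx Dy.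
apply: (is_derive_eq (f := (cst s - t \*: x) ^+ 2 + (t \*: y) ^+ 2)).
transitivity
  (2%:R * (s - t * x u) * (0 - t * dx) + 2%:R * (t * y u) * (t * dy)).
  by [].
ring.
Qed.

Lemma is_derive_potential s1 t1 s2 t2 (x y : R -> R) u (dx dy : R) :
  is_derive u 1 x dx -> is_derive u 1 y dy ->
  0 < gap s1 t1 (x u) (y u) -> 0 < gap s2 t2 (x u) (y u) ->
  is_derive u 1 (fun v => potential s1 t1 s2 t2 (x v) (y v))
    ((t1 ^+ 2 * y u * dy - t1 * (s1 - t1 * x u) * dx) / gap s1 t1 (x u) (y u) -
     (t2 ^+ 2 * y u * dy - t2 * (s2 - t2 * x u) * dx) / gap s2 t2 (x u) (y u)).
Proof.
move=> Dx Dy g1 g2.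
have D s t : 0 < gap s t (x u) (y u) ->
    is_derive u 1 (@ln R \o (fun v => gap s t (x v) (y v)))
     ((gap s t (x u) (y u))^-1 *
      (2%:R * (t ^+ 2 * y u * dy - t * (s - t * x u) * dx))).
  move=> g0; apply: is_derive1_comp; last exact: is_derive_gap.
  exact: is_derive1_ln.
have D1 := D _ _ g1; have D2 := D _ _ g2.
have -> : (fun v => potential s1 t1 s2 t2 (x v) (y v)) =
    2%:R^-1 \*: ((@ln R \o (fun v => gap s1 t1 (x v) (y v))) -
                 (@ln R \o (fun v => gap s2 t2 (x v) (y v)))).
  by apply/funext => v; rewrite /potential mulrC.
apply: is_derive_eq; rewrite -[LHS]/(2%:R^-1 * (_ - _)).
by field; rewrite !gt_eqF.
Qed.

(** With A = s1 - t1 z, B = s2 - t2 z and B' the conjugate of B, this is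
|A|^2 |B|^2 = Im (A B')^2 + Re (A B')^2.  For distinct points s1/t1 and s2/t2
the second term vanishes precisely on the circle through them orthogonal to the
real line. *)
Lemma gap_prod s1 t1 s2 t2 x y :
  gap s1 t1 x y * gap s2 t2 x y = ((s1 * t2 - s2 * t1) * y) ^+ 2
   + (t1 * t2 * (x ^+ 2 + y ^+ 2) + s1 * s2 - (s1 * t2 + s2 * t1) * x) ^+ 2.
Proof. rewrite /gap; ring. Qed.

(** Put A = s1 - t1 z, B = s2 - t2 z and d = s1 t2 - s2 t1.  The Euclidean
gradient of the potential has norm |d| / (|A| |B|), and |d| y <= |A| |B| by
[gap_prod]: in the hyperbolic metric the gradient has norm at most 1.  The rest
is the Cauchy-Schwarz inequality. *)
Lemma potential_slope s1 t1 s2 t2 x y dx dy :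
  (s1 != 0) || (t1 != 0) -> (s2 != 0) || (t2 != 0) -> 0 < y ->
  (t1 ^+ 2 * y * dy - t1 * (s1 - t1 * x) * dx) / gap s1 t1 x y -
  (t2 ^+ 2 * y * dy - t2 * (s2 - t2 * x) * dx) / gap s2 t2 x y
    <= Num.sqrt (dx ^+ 2 + dy ^+ 2) / y.
Proof.
move=> st1 st2 y0; have [g1 g2] := (gap_gt0 x st1 y0, gap_gt0 x st2 y0).
rewrite ler_pdivlMr //; set a := (X in X * y <= _).
apply: (le_trans (ler_norm _)); rewrite -sqrtr_sqr.
rewrite ler_sqrt ?addr_ge0 ?sqr_ge0 //.
set d := s1 * t2 - s2 * t1.
(* The gradient is (- p, q) divided by |A|^2 |B|^2. *)
pose p := t1 * (s1 - t1 * x) * gap s2 t2 x y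
  - t2 * (s2 - t2 * x) * gap s1 t1 x y.
pose q := y * (t1 ^+ 2 * gap s2 t2 x y - t2 ^+ 2 * gap s1 t1 x y).
have G0 : 0 < gap s1 t1 x y * gap s2 t2 x y by rewrite mulr_gt0.
have aE : a = (q * dy - p * dx) / (gap s1 t1 x y * gap s2 t2 x y).
  by rewrite /a /p /q; field; rewrite !gt_eqF.
have cauchy : (q * dy - p * dx) ^+ 2 <= (p ^+ 2 + q ^+ 2) * (dx ^+ 2 + dy ^+ 2).
  rewrite -subr_ge0.
  have -> : (p ^+ 2 + q ^+ 2) * (dx ^+ 2 + dy ^+ 2) - (q * dy - p * dx) ^+ 2
    = (p * dy + q * dx) ^+ 2 by ring.
  exact: sqr_ge0.
have pqE : p ^+ 2 + q ^+ 2 = d ^+ 2 * (gap s1 t1 x y * gap s2 t2 x y).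
  by rewrite /p /q /d /gap; ring.
have dG : (d * y) ^+ 2 <= gap s1 t1 x y * gap s2 t2 x y.
  by rewrite gap_prod lerDl sqr_ge0.
rewrite aE; move: (gap s1 t1 x y * gap s2 t2 x y) G0 pqE dG => G G0 pqE dG.
rewrite mulrAC expr_div_n ler_pdivrMr ?exprn_gt0 // exprMn.
apply: (le_trans (ler_wpM2r (sqr_ge0 y) cauchy)); rewrite pqE.
have -> : d ^+ 2 * G * (dx ^+ 2 + dy ^+ 2) * y ^+ 2
  = (d * y) ^+ 2 * (G * (dx ^+ 2 + dy ^+ 2)) by ring.
have -> : (dx ^+ 2 + dy ^+ 2) * G ^+ 2 = G * (G * (dx ^+ 2 + dy ^+ 2)) by ring.
by apply: ler_wpM2r => //; rewrite mulr_ge0 ?addr_ge0 ?sqr_ge0 ?ltW.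
Qed.

Lemma within_continuous_bounds (f : R -> R) (a b : R) :
  (forall u, a <= u <= b -> {for u, continuous f}) ->
  {within `[a, b], continuous f}.
Proof.
move=> cf; apply: continuous_in_subspaceT => u; rewrite inE /= in_itv /=.
exact: cf.
Qed.

(** By [potential_slope] the derivative of the potential along a curve is at
most the hyperbolic speed; integrate.  Exchanging the two boundary points
changes the sign of the potential, which yields the bound for the absolute
value of the difference. *)
Lemma length_ge_potential (z w : R[i]) (x y : R -> R) s1 t1 s2 t2 :
  (s1 != 0) || (t1 != 0) -> (s2 != 0) || (t2 != 0) ->
  half_plane_curve z w x y ->
  potential s1 t1 s2 t2 (complex.Re w) (complex.Im w)
    - potential s1 t1 s2 t2 (complex.Re z) (complex.Im z)
    <= hyperbolic_length x y.
Proof.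
move=> st1 st2 [[dx cx] [dy cy] y0 <- <-] /=.
have Dx u : is_derive u 1 x (derive1 x u).
  by split; [exact: dx|rewrite derive1E].
have Dy u : is_derive u 1 y (derive1 y u).
  by split; [exact: dy|rewrite derive1E].
have Cx u : {for u, continuous x}.
  exact/differentiable_continuous/derivable1_diffP.
have Cy u : {for u, continuous y}.
  exact/differentiable_continuous/derivable1_diffP.
pose F u := potential s1 t1 s2 t2 (x u) (y u).
pose f' s t u := (t ^+ 2 * y u * derive1 y u - t * (s - t * x u) * derive1 x u)
   / gap s t (x u) (y u).
pose f u := f' s1 t1 u - f' s2 t2 u.
pose h u := Num.sqrt ((derive1 x u) ^+ 2 + (derive1 y u) ^+ 2) / y u.
have DF u : 0 <= u <= 1 -> is_derive u 1 F (f u).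
  move=> u01; apply: (is_derive_potential (Dx u) (Dy u));
    by apply: gap_gt0 => //; exact: y0.
have Cf' s t u : (s != 0) || (t != 0) -> 0 <= u <= 1 ->
    {for u, continuous (f' s t)}.
  move=> st u01.
  have Cg : {for u, continuous (fun v => gap s t (x v) (y v))}.
    apply/differentiable_continuous/derivable1_diffP.
    by have [] := is_derive_gap s t (Dx u) (Dy u).
  apply: continuousM; last first.
    by apply: continuousV => //; rewrite gt_eqF // gap_gt0 // y0.
  apply: continuousB; apply: continuousM; [|exact: cy| |exact: cx].
    by apply: continuousM; [exact: cst_continuous|exact: Cy].
  apply: continuousM; first exact: cst_continuous.
  apply: continuousB; first exact: cst_continuous.
  by apply: continuousM; [exact: cst_continuous|exact: Cx].
have Cf : {within `[0, 1], continuous f}.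
  apply: within_continuous_bounds => u u01.
  by apply: continuousB; exact: Cf'.
have Csq (g : R -> R) u : {for u, continuous g} ->
    {for u, continuous (fun v => g v ^+ 2)}.
  by move=> cg; exact: (continuousM cg cg).
have Ch : {within `[0, 1], continuous h}.
  apply: within_continuous_bounds => u u01; apply: continuousM.
    apply: continuous_comp; last exact: sqrt_continuous.
    by apply: (continuousD (Csq _ _ (cx u)) (Csq _ _ (cy u))).
  by apply: continuousV; [rewrite gt_eqF // y0|exact: Cy].
have CF u : 0 <= u <= 1 -> {for u, continuous F}.
  move=> u01; apply/differentiable_continuous/derivable1_diffP.
  by have [] := DF u u01.
have FTC : \int[lebesgue_measure]_(u in `[0, 1]) f u = F 1 - F 0.
  rewrite /Rintegral (@continuous_FTC2 _ f F) //.
  - split=> [u||].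
    + rewrite in_itv /= => /andP[u0 u1].
      by have [] : is_derive u 1 F (f u) by apply: DF; rewrite !ltW.
    + by apply: cvg_at_right_filter; apply: CF; rewrite lexx ler01.
    + by apply: cvg_at_left_filter; apply: CF; rewrite lexx ler01.
  - move=> u; rewrite in_itv /= => /andP[u0 u1].
    by rewrite derive1E; apply: derive_val; apply: DF; rewrite !ltW.
rewrite -[X in X <= _]FTC; apply: le_Rintegral => //.
- by apply: continuous_compact_integrable => //; exact: segment_compact.
- by apply: continuous_compact_integrable => //; exact: segment_compact.
- move=> u; rewrite /= in_itv /= => u01.
  by apply: potential_slope => //; exact: y0.
Qed.

End HalfPlane.

(** * Geodesics and the Lobachevsky metric *)

Section Geodesic.
Variable R : realType.
Implicit Types (s t x y u : R).

Lemma C1_fun_is_derive (f g : R -> R) :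
  (forall u, is_derive u 1 f (g u)) -> continuous g -> C1_fun f.
Proof.
move=> df cg; split=> [u|]; first by have [] := df u.
suff -> : derive1 f = g by [].
by apply/funext => u; rewrite derive1E; exact: derive_val.
Qed.

Lemma is_derive_quotient (f g : R -> R) u (df dg : R) :
  is_derive u 1 f df -> is_derive u 1 g dg -> g u != 0 ->
  is_derive u 1 (fun v => f v / g v) ((df * g u - f u * dg) / g u ^+ 2).
Proof.
move=> Df Dg g0.
have D := is_deriveM Df (is_deriveV g0 Dg).
apply: (is_derive_eq (D)).
rewrite -[LHS]/(f u * (- (g u) ^- 2 * dg) + (g u)^-1 * df).
by field.
Qed.

(** The points z of the geodesic between s1/t1 and s2/t2 are those for which
(s1 - t1 z) / (s2 - t2 z) = i lambda is purely imaginary; solving for z gives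
[arc_x] and [arc_y].  With lambda = exp (a + c u), the motion is the image of
a hyperbolically uniform motion along the imaginary axis, hence of constant
speed |c|. *)
Section Arc.
Variables s1 t1 s2 t2 : R.
Let d := s1 * t2 - s2 * t1.
Hypothesis d0 : 0 < d.
Variables a c : R.
Let lam u := expR (a + c * u).
Let D u := t1 ^+ 2 + t2 ^+ 2 * lam u ^+ 2.
Definition arc_x u := (s1 * t1 + s2 * t2 * lam u ^+ 2) / D u.
Definition arc_y u := d * lam u / D u.

Let lam_gt0 u : 0 < lam u. Proof. exact: expR_gt0. Qed.

Let D_gt0 u : 0 < D u.
Proof.
rewrite /D; have [t10|t10] := eqVneq t1 0; last first.
  by rewrite ltr_pwDl ?exprn_even_gt0 // mulr_ge0 ?sqr_ge0.
rewrite t10 expr0n add0r; apply: mulr_gt0; last exact: exprn_gt0.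
rewrite exprn_even_gt0 //=.
by apply: contraTneq d0 => t20; rewrite /d t10 t20 !mulr0 subrr ltxx.
Qed.

Lemma arc_y_gt0 u : 0 < arc_y u.
Proof. by rewrite divr_gt0 // mulr_gt0. Qed.

Let D_lam u : is_derive u 1 lam (c * lam u).
Proof.
have Da : is_derive u 1 (cst a + c \*: id) (0 + c *: 1) by apply: is_derive_eq.
have := is_derive1_comp (is_derive_expR _) Da.
move=> De; apply: (is_derive_eq De).
by rewrite add0r /GRing.scale /= mulr1 mulrC.
Qed.

Let D_poly p q u :
  is_derive u 1 (fun v => p + q * lam v ^+ 2) (2%:R * c * q * lam u ^+ 2).
Proof.
have Dl := D_lam u.
apply: (is_derive_eq (f := cst p + q \*: (lam ^+ 2))).
transitivity (0 + q * (2%:R * lam u * (c * lam u))); first by [].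
ring.
Qed.

Let arc_x' u := - (2%:R * c * t1 * t2 * d) * lam u ^+ 2 / D u ^+ 2.
Let arc_y' u := c * d * lam u * (t1 ^+ 2 - t2 ^+ 2 * lam u ^+ 2) / D u ^+ 2.

Let D_arc_x u : is_derive u 1 arc_x (arc_x' u).
Proof.
have Dn0 : D u != 0 by rewrite gt_eqF.
apply: (is_derive_eq (is_derive_quotient (D_poly _ _ u) (D_poly _ _ u) Dn0)).
rewrite /arc_x'; congr (_ / _); rewrite /D /d; ring.
Qed.

Let D_arc_y u : is_derive u 1 arc_y (arc_y' u).
Proof.
have Dn0 : D u != 0 by rewrite gt_eqF.
have Dl : is_derive u 1 (fun v => d * lam v) (d * (c * lam u)).
  exact: is_deriveZ.
apply: (is_derive_eq (is_derive_quotient Dl (D_poly _ _ u) Dn0)).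
rewrite /arc_y'; congr (_ / _); rewrite /D /d; ring.
Qed.

Let cont_lam : continuous lam.
Proof.
move=> u; apply/differentiable_continuous/derivable1_diffP.
by have [] := D_lam u.
Qed.

Let cont_poly p q : continuous (fun v => p + q * lam v ^+ 2).
Proof.
by move=> u; apply/differentiable_continuous/derivable1_diffP;
  have [] := D_poly p q u.
Qed.

Let cont_invD : continuous (fun u => (D u ^+ 2)^-1).
Proof.
move=> u; apply: (@continuousV _ _ (fun u => D u ^+ 2) u).
  by rewrite gt_eqF // exprn_gt0.
exact: (continuousM (@cont_poly _ _ u) (@cont_poly _ _ u)).
Qed.

Lemma arc_C1 : C1_fun arc_x /\ C1_fun arc_y.
Proof.
have cc (k : R) : continuous (fun _ : R => k).
  by move=> u; exact: cst_continuous.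
split.
  apply: (C1_fun_is_derive D_arc_x) => u.
  apply: (continuousM _ (@cont_invD u)); apply: (continuousM (@cc _ u)).
  exact: (continuousM (@cont_lam u) (@cont_lam u)).
apply: (C1_fun_is_derive D_arc_y) => u.
apply: (continuousM _ (@cont_invD u)).
apply: (continuousM (continuousM (@cc _ u) (@cont_lam u))).
apply: continuousB; first exact: cst_continuous.
apply: (continuousM (@cc _ u)).
exact: (continuousM (@cont_lam u) (@cont_lam u)).
Qed.

Lemma arc_length : hyperbolic_length arc_x arc_y = `|c|.
Proof.
have speed u : Num.sqrt ((derive1 arc_x u) ^+ 2 + (derive1 arc_y u) ^+ 2)
    / arc_y u = `|c|.
  rewrite !derive1E (@derive_val _ _ _ _ _ _ _ (D_arc_x u)).
  rewrite (@derive_val _ _ _ _ _ _ _ (D_arc_y u)).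
  have -> : arc_x' u ^+ 2 + arc_y' u ^+ 2 = (c * arc_y u) ^+ 2.
    rewrite /arc_x' /arc_y' /arc_y.
    have Dn0 : D u != 0 by rewrite gt_eqF.
    apply: (mulIf (expf_neq0 4 Dn0)).
    transitivity ((2%:R * c * t1 * t2 * d * lam u ^+ 2) ^+ 2 +
      (c * d * lam u * (t1 ^+ 2 - t2 ^+ 2 * lam u ^+ 2)) ^+ 2); first by field.
    transitivity ((c * d * lam u) ^+ 2 * D u ^+ 2); last by field.
    rewrite /D; ring.
  rewrite sqrtr_sqr normrM (gtr0_norm (arc_y_gt0 u)) mulfK //.
  by rewrite gt_eqF ?arc_y_gt0.
rewrite /hyperbolic_length.
under eq_Rintegral do rewrite speed.
rewrite Rintegral_cst //= lebesgue_measure_itv /= lte_fin ltr01.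
by rewrite oppr0 adde0 mulr1.
Qed.

End Arc.

(** The equations say that both points lie on the geodesic from s1/t1 to s2/t2.
Its arc between them has as length the difference of the potentials, and by
[length_ge_potential] no curve is shorter. *)
Lemma lobachevsky_potential s1 t1 s2 t2 x1 y1 x2 y2 :
  0 < s1 * t2 - s2 * t1 -> 0 < y1 -> 0 < y2 ->
  t1 * t2 * (x1 ^+ 2 + y1 ^+ 2) + s1 * s2 - (s1 * t2 + s2 * t1) * x1 = 0 ->
  t1 * t2 * (x2 ^+ 2 + y2 ^+ 2) + s1 * s2 - (s1 * t2 + s2 * t1) * x2 = 0 ->
  lobachevsky (x1 +i* y1) (x2 +i* y2)
    = `|potential s1 t1 s2 t2 x1 y1 - potential s1 t1 s2 t2 x2 y2|.
Proof.
move=> d0 y10 y20 o1 o2; have [st1 st2] := det_gt0_neq0 d0.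
set d := s1 * t2 - s2 * t1 in d0.
(* The parameter lambda of the point x + i y on the geodesic; its logarithm is
   the potential. *)
pose lam x y := y * d / gap s2 t2 x y.
have lamP x y : 0 < y ->
    t1 * t2 * (x ^+ 2 + y ^+ 2) + s1 * s2 - (s1 * t2 + s2 * t1) * x = 0 ->
    [/\ 0 < lam x y, ln (lam x y) = potential s1 t1 s2 t2 x y,
     (s1 * t1 + s2 * t2 * lam x y ^+ 2)
       / (t1 ^+ 2 + t2 ^+ 2 * lam x y ^+ 2) = x &
     d * lam x y / (t1 ^+ 2 + t2 ^+ 2 * lam x y ^+ 2) = y].
  move=> y0 o; have [g1 g2] := (gap_gt0 x st1 y0, gap_gt0 x st2 y0).
  have l0 : 0 < lam x y by rewrite divr_gt0 // mulr_gt0.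
  have gg : gap s1 t1 x y * gap s2 t2 x y = (d * y) ^+ 2.
    by rewrite gap_prod o expr0n addr0.
  have l2 : lam x y ^+ 2 = gap s1 t1 x y / gap s2 t2 x y.
    rewrite /lam expr_div_n (mulrC y) -gg; field; exact: lt0r_neq0.
  have Dg : (t1 ^+ 2 * gap s2 t2 x y + t2 ^+ 2 * gap s1 t1 x y) = d ^+ 2.
    rewrite -[RHS]addr0 -(mulr0 (2%:R * t1 * t2)) -o /d /gap; ring.
  have xg : s1 * t1 * gap s2 t2 x y + s2 * t2 * gap s1 t1 x y = d ^+ 2 * x.
    rewrite -[RHS]addr0 -(mulr0 (s1 * t2 + s2 * t1)) -o /d /gap; ring.
  have gn := lt0r_neq0 g2; have dn := lt0r_neq0 d0.
  have dd : t1 ^+ 2 + t2 ^+ 2 * lam x y ^+ 2 = d ^+ 2 / gap s2 t2 x y.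
    by rewrite -Dg l2; field.
  split=> //.
  - rewrite /potential -ln_div ?posrE // -l2 lnXn //.
    by rewrite -(mulr_natr (ln _)) mulfK // pnatr_eq0.
  - have -> : s1 * t1 + s2 * t2 * lam x y ^+ 2 = d ^+ 2 * x / gap s2 t2 x y.
      by rewrite -xg l2; field.
    by rewrite dd; field; rewrite dn gn.
  - by rewrite dd /lam; field; rewrite dn gn.
have [l10 P1 X1 Y1] := lamP _ _ y10 o1; have [l20 P2 X2 Y2] := lamP _ _ y20 o2.
pose c := ln (lam x2 y2) - ln (lam x1 y1).
have addcE : ln (lam x1 y1) + c = ln (lam x2 y2) by rewrite addrC subrK.
pose ax := arc_x s1 t1 s2 t2 (ln (lam x1 y1)) c.
pose ay := arc_y s1 t1 s2 t2 (ln (lam x1 y1)) c.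
have curve : half_plane_curve (x1 +i* y1) (x2 +i* y2) ax ay.
  have [Cx Cy] := arc_C1 d0 (ln (lam x1 y1)) c.
  split=> //.
  - by move=> u _; exact: arc_y_gt0.
  - by rewrite /ax /ay /arc_x /arc_y mulr0 addr0 lnK ?posrE // X1 Y1.
  - by rewrite /ax /ay /arc_x /arc_y mulr1 addcE lnK ?posrE // X2 Y2.
have len : hyperbolic_length ax ay = `|c| by exact: arc_length.
have antisym x y : potential s2 t2 s1 t1 x y = - potential s1 t1 s2 t2 x y.
  by rewrite /potential -mulNr opprB.
rewrite -P1 -P2 distrC -/c /lobachevsky; set S := [set _ | _].
have lb : lbound S `|c|.
  move=> _ [x [y [xy ->]]]; rewrite /c P1 P2 ler_norml.
  have := length_ge_potential st1 st2 xy.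
  have := length_ge_potential st2 st1 xy.
  by rewrite !antisym /= -opprD lerNl => -> ->.
have Sc : S `|c| by exists ax, ay; split.
apply/eqP; rewrite eq_le; apply/andP; split.
  by apply: ge_inf => //; exists `|c|.
by apply: lb_le_inf => //; exists `|c|.
Qed.

End Geodesic.

(** * The construction for points of the half-plane *)

Section PointCycles.
Variable R : realType.
Local Notation C := R[i].
Implicit Types (s t x y : R) (z : C).

(** The cycle (k, l, 0, m) orthogonal to both points meets the real line where
k s^2 - 2 l s t + m t^2 = 0, with discriminant l^2 - k m > 0.  The roots
l + e : k and m : l + e, with e the square root of the discriminant, cover also
the case k = 0, at the price of requiring l >= 0. *)
Lemma geodesic_ends x1 y1 x2 y2 :
  0 < y1 -> 0 < y2 -> (x1, y1) != (x2, y2) ->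
  exists s1 t1 s2 t2,
  [/\ 0 < s1 * t2 - s2 * t1,
    t1 * t2 * (x1 ^+ 2 + y1 ^+ 2) + s1 * s2 - (s1 * t2 + s2 * t1) * x1 = 0 &
    t1 * t2 * (x2 ^+ 2 + y2 ^+ 2) + s1 * s2 - (s1 * t2 + s2 * t1) * x2 = 0].
Proof.
(* Exchanging the points changes the sign of l. *)
wlog le21 : x1 y1 x2 y2 / x2 ^+ 2 + y2 ^+ 2 <= x1 ^+ 2 + y1 ^+ 2 => [wl|].
  have [|/ltW] := lerP (x2 ^+ 2 + y2 ^+ 2) (x1 ^+ 2 + y1 ^+ 2).
    by move=> /wl; apply.
  move=> /wl {}wl y10 y20; rewrite eq_sym => neq.
  have [s1 [t1 [s2 [t2 [d0 o1 o2]]]]] := wl y20 y10 neq.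
  by exists s1, t1, s2, t2.
move=> y10 y20 neq.
pose n1 := x1 ^+ 2 + y1 ^+ 2; pose n2 := x2 ^+ 2 + y2 ^+ 2.
pose k := 2%:R * (x1 - x2); pose l := n1 - n2.
pose m := 2%:R * (x2 * n1 - x1 * n2).
have disc0 : 0 < l ^+ 2 - k * m.
  have -> : l ^+ 2 - k * m = ((x1 - x2) ^+ 2 + (y1 - y2) ^+ 2)
      * ((x1 - x2) ^+ 2 + (y1 + y2) ^+ 2).
    by rewrite /k /l /m /n1 /n2; ring.
  rewrite mulr_gt0 //; last first.
    by rewrite ltr_wpDl ?sqr_ge0 // exprn_gt0 // addr_gt0.
  rewrite lt0r addr_ge0 ?sqr_ge0 // andbT paddr_eq0 ?sqr_ge0 // !sqrf_eq0.
  by rewrite !subr_eq0.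
pose e := Num.sqrt (l ^+ 2 - k * m).
have e0 : 0 < e by rewrite sqrtr_gt0.
have e2 : e ^+ 2 = l ^+ 2 - k * m by rewrite sqr_sqrtr // ltW.
have l0 : 0 <= l by rewrite subr_ge0.
have sum : (l + e) * (l + e) + m * k = 2%:R * l * (l + e).
  transitivity (l ^+ 2 + 2%:R * l * e + e ^+ 2 + m * k); first by ring.
  by rewrite e2; ring.
exists (l + e), k, m, (l + e); rewrite sum; split.
- have -> : (l + e) * (l + e) - m * k = 2%:R * e * (l + e).
    transitivity (l ^+ 2 - k * m + 2%:R * l * e + e ^+ 2); first by ring.
    by rewrite -e2; ring.
  by rewrite !mulr_gt0 // ltr_wpDl.
- by rewrite /k /l /m /n1 /n2; ring.
- by rewrite /k /l /m /n1 /n2; ring.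
Qed.

Lemma cprod_point_real_point z s t :
  cprod (point_cyc z) (real_point s t) = gap s t (complex.Re z) (complex.Im z).
Proof. rewrite /cprod /gap /=; ring. Qed.

Lemma cprod_real_points s1 t1 s2 t2 :
  cprod (real_point s1 t1) (real_point s2 t2) = (s1 * t2 - s2 * t1) ^+ 2.
Proof. rewrite /cprod /=; ring. Qed.

Lemma associated_points (z1 z2 : C) s1 t1 s2 t2 :
  0 < complex.Im z1 -> 0 < complex.Im z2 -> z1 != z2 ->
  0 < s1 * t2 - s2 * t1 ->
  (forall z, z = z1 \/ z = z2 ->
    t1 * t2 * (complex.Re z ^+ 2 + complex.Im z ^+ 2) + s1 * s2
      - (s1 * t2 + s2 * t1) * complex.Re z = 0) ->
  associated (point_cyc z1) (point_cyc z2)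
    (Cyc (t1 * t2) ((s1 * t2 + s2 * t1) / 2%:R) 0 (s1 * s2))
    (cplx (real_point s1 t1)) (cplx (real_point s2 t2)).
Proof.
move=> y10 y20 z12 d0 on; set D := Cyc _ _ _ _.
have [st1 st2] := det_gt0_neq0 d0.
have nzpt z : nonzero_cyc (point_cyc z).
  by move=> [] /eqP; rewrite oner_eq0.
have nline z : ~ same_cycle (point_cyc z) (real_line R).
  by move=> [a a0 []] /eqP; rewrite mulr1 eq_sym (negPf a0).
have oD z : z = z1 \/ z = z2 -> orthogonal_cyc D (point_cyc z).
  by move=> /on o; rewrite /orthogonal_cyc -o /cprod /=; field.
have iZ s t : (s != 0) || (t != 0) -> orthogonal_cyc (real_point s t) D ->
    intersection_point D (cplx (real_point s t)).
  move=> st oZ; split.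
  - apply: nonzero_cplx => -[/eqP + _ /eqP]; rewrite !sqrf_eq0 => t0 s0.
    by rewrite s0 t0 in st.
  - exact/orthogonal_cplx.
  - by rewrite -cplx_real_line; apply/orthogonal_cplx/orthogonal_real_line.
  - apply/orthogonal_cplx.
    by rewrite /orthogonal_cyc cprod_real_points subrr expr0n.
have nz z s t : 0 < complex.Im z -> (s != 0) || (t != 0) ->
    cprod (cplx (point_cyc z)) (cplx (real_point s t)) != 0.
  move=> y0 st; rewrite cprod_cplx fmorph_eq0 cprod_point_real_point.
  by rewrite gt_eqF // gap_gt0.
split.
- split=> // -[a _ [+ E1 E2 _]]; rewrite mulr1 => a1.
  move/eqP: z12; apply; move: E1 E2; rewrite -a1 !mul1r.
  by case: (z1) (z2) => x1 y1 [x2 y2] /= -> ->.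
- split; last exact/orthogonal_real_line.
  + move=> [t0 + s0] => /eqP.
    rewrite mulf_eq0 invr_eq0 pnatr_eq0 orbF => /eqP S0.
    move: d0; rewrite lt0r => /andP[/negP + _]; apply.
    rewrite -sqrf_eq0; apply/eqP.
    transitivity ((s1 * t2 + s2 * t1) ^+ 2 - 4%:R * (t1 * t2) * (s1 * s2)).
      by ring.
    by rewrite S0 t0 expr0n !mulr0 !mul0r subrr.
  + by apply: oD; left.
  + by apply: oD; right.
- split.
  + by apply: iZ => //; rewrite /orthogonal_cyc /cprod /=; field.
  + by apply: iZ => //; rewrite /orthogonal_cyc /cprod /=; field.
  + move=> [a a0 E]; have := cprod_cplx (real_point s1 t1) (real_point s2 t2).
    rewrite E cprod_scaler cprod_cplx !cprod_real_points subrr expr0n mulr0.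
    by move=> /esym/eqP; rewrite fmorph_eq0 sqrf_eq0 gt_eqF.
- by split; exact: nz.
Qed.

End PointCycles.

(** * The distance between cycles *)

Section Distance.
Variable R : realType.
Local Notation C := R[i].
Implicit Types (A B D : cyc R) (Z W : cyc C).

Lemma dist_pos A B Z W (r : R) : 0 < r ->
  cross_ratio (cplx A) (cplx B) Z W = r%:C -> dist A B Z W = (ln r / 2%:R)%:C.
Proof. by move=> r0 E; rewrite /dist E Log_pos // fmorph_div rmorph_nat. Qed.

Lemma dist_same A A' B B' Z W :
  same_cycle A A' -> same_cycle B B' -> dist A' B' Z W = dist A B Z W.
Proof.
move=> s1 s2; congr (Log _ / _); apply: cross_ratio_same;
  by [exact: same_cycle_cplx | exact: same_cycle_refl].
Qed.

Lemma dist_unique A B D D' Z1 Z2 W1 W2 :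
  associated A B D Z1 Z2 -> associated A B D' W1 W2 ->
  dist A B W1 W2 = dist A B Z1 Z2 \/ dist A B W1 W2 = dist A B Z2 Z1.
Proof.
move=> aZ aW; rewrite /dist.
by case: (cross_ratio_unique aZ aW) => ->; [left|right].
Qed.

Lemma dist_mobius (M : 'M[R]_2) A B Z1 Z2 : \det M = 1 ->
  dist (mobius M A) (mobius M B) (mobiusC M Z1) (mobiusC M Z2)
  = dist A B Z1 Z2.
Proof. by move=> dM; congr (Log _ / _); exact: cross_ratio_mobius. Qed.

Lemma cprod_neq0_line Z A : orthogonal_cyc Z (real_line C) ->
  cprod (cplx A) Z != 0 -> ~ same_cycle A (real_line R).
Proof.
move=> oZ n0 /same_cycle_cplx /same_cycle_sym[a a0 E]; move/negP: n0; apply.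
by rewrite E cplx_real_line cprod_scalel cprodC oZ mulr0.
Qed.

(** The product of z with the point s/t is [gap s t z], so the distance is the
difference of the potentials at z1 and z2; its sign depends on the order of the
intersection points. *)
Lemma dist_points (z1 z2 : C) :
  0 < complex.Im z1 -> 0 < complex.Im z2 -> z1 != z2 ->
  exists D Z1 Z2, [/\ associated (point_cyc z1) (point_cyc z2) D Z1 Z2,
    dist (point_cyc z1) (point_cyc z2) Z2 Z1
      = - dist (point_cyc z1) (point_cyc z2) Z1 Z2
  & dist (point_cyc z1) (point_cyc z2) Z1 Z2 = (lobachevsky z1 z2)%:C \/
    - dist (point_cyc z1) (point_cyc z2) Z1 Z2 = (lobachevsky z1 z2)%:C].
Proof.
case: z1 z2 => x1 y1 [x2 y2] /= y10 y20 z12.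
have neq : (x1, y1) != (x2, y2) by apply: contraNneq z12 => -[-> ->].
have [s1 [t1 [s2 [t2 [d0 o1 o2]]]]] := geodesic_ends y10 y20 neq.
have assoc : associated (point_cyc (x1 +i* y1)) (point_cyc (x2 +i* y2))
    (Cyc (t1 * t2) ((s1 * t2 + s2 * t1) / 2%:R) 0 (s1 * s2))
    (cplx (real_point s1 t1)) (cplx (real_point s2 t2)).
  by apply: associated_points => // z [] ->.
have [st1 st2] := det_gt0_neq0 d0.
have distE s t s' t' : (s != 0) || (t != 0) -> (s' != 0) || (t' != 0) ->
    dist (point_cyc (x1 +i* y1)) (point_cyc (x2 +i* y2))
      (cplx (real_point s t)) (cplx (real_point s' t'))
    = (potential s t s' t' x1 y1 - potential s t s' t' x2 y2)%:C.
  move=> st st'.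
  have g p q x y : (p != 0) || (q != 0) -> 0 < y -> gap p q x y \is Num.pos.
    by move=> pq y0; rewrite posrE gap_gt0.
  rewrite (@dist_pos _ _ _ _ (gap s t x1 y1 / gap s' t' x1 y1
      / (gap s t x2 y2 / gap s' t' x2 y2))).
  - rewrite !ln_div ?posrE ?divr_gt0 -?posrE ?g // /potential.
    by congr (_%:C); field.
  - by rewrite !divr_gt0 -?posrE ?g.
  - rewrite /cross_ratio !cprod_cplx !cprod_point_real_point /=.
    by rewrite !fmorph_div.
have swap : potential s2 t2 s1 t1 x1 y1 - potential s2 t2 s1 t1 x2 y2 =
    - (potential s1 t1 s2 t2 x1 y1 - potential s1 t1 s2 t2 x2 y2).
  by rewrite /potential; field.
have lobE := lobachevsky_potential d0 y10 y20 o1 o2.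
exists (Cyc (t1 * t2) ((s1 * t2 + s2 * t1) / 2%:R) 0 (s1 * s2)),
  (cplx (real_point s1 t1)), (cplx (real_point s2 t2)).
rewrite !distE // swap lobE rmorphN /=; split=> //.
by case: ger0P => _; [left|right; rewrite rmorphN].
Qed.

End Distance.

Section Proposition.
Variable R : realType.
Local Notation C := R[i].

(** The Moebius images of D, Z1 and Z2 arise from A' and B' by the construction,
and any other outcome of it differs at most by the order of the points. *)
Lemma dist_mobius_any (M : 'M[R]_2) (A B D A' B' D' : cyc R)
    (Z1 Z2 W1 W2 : cyc C) :
  \det M = 1 -> associated A B D Z1 Z2 ->
  same_cycle (mobius M A) A' -> same_cycle (mobius M B) B' ->
  associated A' B' D' W1 W2 ->
  dist A' B' W1 W2 = dist A B Z1 Z2 \/ dist A' B' W1 W2 = dist A B Z2 Z1.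
Proof.
move=> dM aZ sA sB aW; rewrite (dist_same _ _ sA sB).
rewrite -(dist_mobius A B Z1 Z2 dM) -(dist_mobius A B Z2 Z1 dM).
apply: dist_unique; first exact: associated_mobius dM aZ.
by apply: associated_same aW; exact: same_cycle_sym.
Qed.

Lemma associated_flip (A B D : cyc R) (Z1 Z2 : cyc C) :
  associated A B D Z1 Z2 -> associated A B D Z2 Z1.
Proof.
move=> [nz oD [iZ1 iZ2 ns] [n11 n12 n21 n22]].
by split=> //; split=> // /same_cycle_sym.
Qed.

Lemma dist_lobachevsky (z1 z2 : C) (A B D : cyc R) (Z1 Z2 : cyc C) :
  0 < complex.Im z1 -> 0 < complex.Im z2 -> z1 != z2 ->
  same_cycle (point_cyc z1) A -> same_cycle (point_cyc z2) B ->
  associated A B D Z1 Z2 ->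
  dist A B Z1 Z2 = (lobachevsky z1 z2)%:C \/
  dist A B Z2 Z1 = (lobachevsky z1 z2)%:C.
Proof.
move=> y1 y2 z12 sA sB aZ; rewrite !(dist_same _ _ sA sB).
have [E [W1 [W2 [aW oppW lobW]]]] := dist_points y1 y2 z12.
have {aZ} aZ : associated (point_cyc z1) (point_cyc z2) D Z1 Z2.
  by apply: associated_same aZ; exact: same_cycle_sym.
case: lobW => lobW.
  by have [<-|<-] := dist_unique aZ aW; [left|right].
rewrite -oppW in lobW.
by have [<-|<-] := dist_unique aZ (associated_flip aW); [left|right].
Qed.

Lemma associated_replace (A B E D : cyc R) (Z1 Z2 : cyc C) :
  associated A B D Z1 Z2 -> nonzero_cyc E -> orthogonal_cyc E D ->
  cprod (cplx E) Z1 != 0 -> cprod (cplx E) Z2 != 0 ->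
  ~ same_cycle A E -> associated A E D Z1 Z2.
Proof.
move=> [[nzA _ _ rA _] [nzD oA _ oR] [iZ1 iZ2 ns] [n11 n12 _ _]] nzE oE nE1 nE2.
move=> nAE; split=> //; split=> //.
  by have [_ _ oZ _] := iZ1; exact: cprod_neq0_line oZ nE1.
by rewrite /orthogonal_cyc cprodC.
Qed.

Lemma associated_swap (A B D : cyc R) (Z1 Z2 : cyc C) :
  associated A B D Z1 Z2 -> associated B A D Z1 Z2.
Proof.
move=> [[nzA nzB nAB rA rB] [nzD oA oB oR] iZ [n11 n12 n21 n22]].
by split=> //; split=> // /same_cycle_sym.
Qed.

Lemma dist_additive (A B E : cyc R) (Z1 Z2 : cyc C) :
  cprod (cplx A) Z1 != 0 -> cprod (cplx A) Z2 != 0 ->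
  cprod (cplx B) Z1 != 0 -> cprod (cplx B) Z2 != 0 ->
  cprod (cplx E) Z1 != 0 -> cprod (cplx E) Z2 != 0 ->
  eqmod_ipi (dist A E Z1 Z2) (dist A B Z1 Z2 + dist B E Z1 Z2).
Proof.
move=> a1 a2 b1 b2 e1 e2; rewrite /dist -mulrDl; apply: eqmod_ipi_half.
rewrite -(cross_ratio_chain _ _ b1 b2).
by apply: Log_mul; rewrite !mulf_neq0 ?invr_eq0 ?mulf_neq0 ?invr_eq0.
Qed.

Lemma dist_additive_pos (A B E : cyc R) (Z1 Z2 : cyc C) :
  cprod (cplx B) Z1 != 0 -> cprod (cplx B) Z2 != 0 ->
  0 < cross_ratio (cplx A) (cplx B) Z1 Z2 ->
  0 < cross_ratio (cplx B) (cplx E) Z1 Z2 ->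
  dist A E Z1 Z2 = dist A B Z1 Z2 + dist B E Z1 Z2.
Proof.
move=> b1 b2 /gt0_complexP[r r0 rE] /gt0_complexP[s s0 sE].
rewrite (dist_pos r0 rE) (dist_pos s0 sE) (@dist_pos _ _ _ _ _ (r * s)).
- by rewrite lnM ?posrE // mulrDl rmorphD.
- exact: mulr_gt0.
- by rewrite -(cross_ratio_chain _ _ b1 b2) rE sE rmorphM.
Qed.

(** The imaginary axis (0, 1, 0, 0) is orthogonal to A, B and the real line, so
uniqueness forces D to be the imaginary axis, which meets the real line where
s t = 0. *)
Lemma vertical_ends (A B D : cyc R) (Z1 Z2 : cyc C) :
  cl A = 0 -> cl B = 0 -> associated A B D Z1 Z2 ->
  (forall E, triorthogonal A B E -> same_cycle D E) ->
  (same_cycle (origin_cyc _) Z1 /\ same_cycle (infinity_cyc _) Z2) \/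
  (same_cycle (infinity_cyc _) Z1 /\ same_cycle (origin_cyc _) Z2).
Proof.
move=> lA lB [_ _ [iZ1 iZ2 ns] _] uniqD.
have axis : triorthogonal A B (Cyc 0 1 0 0).
  split; first by move=> [] /eqP; rewrite oner_eq0.
  - by rewrite /orthogonal_cyc /cprod /= lA; ring.
  - by rewrite /orthogonal_cyc /cprod /= lB; ring.
  - exact/orthogonal_real_line.
have /same_cycle_cplx Daxis := uniqD _ axis.
have ends Z : intersection_point D Z ->
    same_cycle (origin_cyc _) Z \/ same_cycle (infinity_cyc _) Z.
  move=> [nzZ oZ rZ nZ]; have [s [t sZ]] := real_pointP nzZ rZ nZ.
  have : s * t = 0.
    have := orthogonal_same (same_cycle_sym sZ) Daxis oZ.
    rewrite /orthogonal_cyc /cprod /= rmorph0 rmorph1.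
    have -> : t ^+ 2 * 0 + 0 * s ^+ 2 - 2%:R * (s * t) * 1 - 2%:R * 0 * 0
      = (- 2%:R) * (s * t) by ring.
    by move/eqP; rewrite mulf_eq0 oppr_eq0 pnatr_eq0 => /eqP.
  have nzst := nonzero_same (same_cycle_sym sZ) nzZ.
  move=> /eqP; rewrite mulf_eq0 => /orP[]/eqP e0; [left|right].
    apply: (same_cycle_trans _ sZ); exists (t ^+ 2).
      by apply: contra_notN nzst; rewrite sqrf_eq0 e0 => /eqP ->;
        rewrite /real_point mul0r expr0n.
    by rewrite /real_point /scale_cyc e0 /= mulr1 !mul0r mulr0 expr0n.
  apply: (same_cycle_trans _ sZ); exists (s ^+ 2).
    by apply: contra_notN nzst; rewrite sqrf_eq0 e0 => /eqP ->;
      rewrite /real_point mul0r expr0n.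
  by rewrite /real_point /scale_cyc e0 /= mulr1 !mulr0 expr0n.
have coll Z : same_cycle Z Z1 -> same_cycle Z Z2 -> False.
  by move=> /same_cycle_sym s1 s2; exact/ns/(same_cycle_trans s1).
have [e1|e1] := ends _ iZ1; have [e2|e2] := ends _ iZ2.
- by case: (coll _ e1 e2).
- by left.
- by right.
- by case: (coll _ e1 e2).
Qed.

(** The products of a cycle with the points 0 and infinity are its coordinates m
and k. *)
Lemma cross_ratio_vertical (A B : cyc R) (Z1 Z2 : cyc C) :
  same_cycle (origin_cyc _) Z1 -> same_cycle (infinity_cyc _) Z2 ->
  cross_ratio (cplx A) (cplx B) Z1 Z2 = (cm A / ck A / (cm B / ck B))%:C.
Proof.
move=> s1 s2.
rewrite (cross_ratio_same (same_cycle_refl _) (same_cycle_refl _) s1 s2).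
have o X : cprod X (origin_cyc C) = cm X by rewrite /cprod /=; ring.
have i X : cprod X (infinity_cyc C) = ck X by rewrite /cprod /=; ring.
by rewrite /cross_ratio !o !i !fmorph_div.
Qed.

Lemma dist_vertical (A B : cyc R) (Z1 Z2 : cyc C) :
  ck A != 0 -> ck B != 0 ->
  cprod (cplx A) Z1 != 0 -> cprod (cplx B) Z1 != 0 ->
  same_cycle (origin_cyc _) Z1 -> same_cycle (infinity_cyc _) Z2 ->
  eqmod_ipi (dist A B Z1 Z2)
    ((Log (cm A / ck A)%:C - Log (cm B / ck B)%:C) / 2%:R).
Proof.
move=> kA kB nA nB s1 s2; rewrite /dist (cross_ratio_vertical A B s1 s2).
have mn0 (E : cyc R) : cprod (cplx E) Z1 != 0 -> cm E != 0.
  have [a a0 ->] := s1; apply: contraNneq => m0.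
  by rewrite cprod_scaler /cprod /= m0 rmorph0; apply/eqP; ring.
apply: eqmod_ipi_half.
have p0 : (cm A / ck A / (cm B / ck B))%:C != 0.
  by rewrite fmorph_eq0 !mulf_neq0 ?invr_eq0 ?mulf_neq0 ?invr_eq0 ?mn0.
have q0 : (cm B / ck B)%:C != 0.
  by rewrite fmorph_eq0 !mulf_neq0 ?invr_eq0 ?mn0.
have [j] := Log_mul p0 q0; rewrite -rmorphM /= divfK; last first.
  by rewrite !mulf_neq0 ?invr_eq0 ?mn0.
move=> ->; exists (- j); rewrite mulrNz mulNr rmorphN; ring.
Qed.

Lemma cl_centre (A : cyc R) :
  ck A != 0 -> complex.Re (centre A) = 0 -> cl A = 0.
Proof.
move=> kA; rewrite /centre -fmorphV /=; simpc => /eqP.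
by rewrite /= mulf_eq0 invr_eq0 (negPf kA) orbF => /eqP.
Qed.

End Proposition.

Theorem proposition14 (R : realType) :
  [/\ (* (i) *)
      (forall (M : 'M[R]_2) (C1 C2 C : cyc R) (Z1 Z2 : cyc R[i]),
          \det M = 1 -> associated C1 C2 C Z1 Z2 ->
        [/\ associated (mobius M C1) (mobius M C2) (mobius M C)
                       (mobiusC M Z1) (mobiusC M Z2),
            dist (mobius M C1) (mobius M C2) (mobiusC M Z1) (mobiusC M Z2)
              = dist C1 C2 Z1 Z2
          & forall (D1 D2 D : cyc R) (W1 W2 : cyc R[i]),
              same_cycle (mobius M C1) D1 -> same_cycle (mobius M C2) D2 ->
              associated D1 D2 D W1 W2 ->
              dist D1 D2 W1 W2 = dist C1 C2 Z1 Z2 \/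
              dist D1 D2 W1 W2 = dist C1 C2 Z2 Z1]),
      (* (ii) *)
      (forall (z1 z2 : R[i]) (C1 C2 : cyc R),
          0 < complex.Im z1 -> 0 < complex.Im z2 -> z1 != z2 ->
          same_cycle (point_cyc z1) C1 -> same_cycle (point_cyc z2) C2 ->
        (exists (C : cyc R) (Z1 Z2 : cyc R[i]), associated C1 C2 C Z1 Z2) /\
        (forall (C : cyc R) (Z1 Z2 : cyc R[i]),
            associated C1 C2 C Z1 Z2 ->
          dist C1 C2 Z1 Z2 = (lobachevsky z1 z2)%:C \/
          dist C1 C2 Z2 Z1 = (lobachevsky z1 z2)%:C)),
      (* (iii) *)
      (forall (C1 C2 C3 C : cyc R) (Z1 Z2 : cyc R[i]),
          associated C1 C2 C Z1 Z2 ->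
          nonzero_cyc C3 -> orthogonal_cyc C3 C ->
          cprod (cplx C3) Z1 != 0 -> cprod (cplx C3) Z2 != 0 ->
        [/\ (~ same_cycle C1 C3 -> associated C1 C3 C Z1 Z2),
            (~ same_cycle C2 C3 -> associated C2 C3 C Z1 Z2),
            eqmod_ipi (dist C1 C3 Z1 Z2) (dist C1 C2 Z1 Z2 + dist C2 C3 Z1 Z2)
          & 0 < cross_ratio (cplx C1) (cplx C2) Z1 Z2 ->
            0 < cross_ratio (cplx C2) (cplx C3) Z1 Z2 ->
            dist C1 C3 Z1 Z2 = dist C1 C2 Z1 Z2 + dist C2 C3 Z1 Z2])
    & (* (iv) *)
      (forall (C1 C2 C : cyc R) (Z1 Z2 : cyc R[i]),
          ck C1 != 0 -> ck C2 != 0 ->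
          complex.Re (centre C1) = 0 -> complex.Re (centre C2) = 0 ->
          associated C1 C2 C Z1 Z2 ->
        [/\ (forall D : cyc R, triorthogonal C1 C2 D -> same_cycle C D) ->
              (same_cycle (origin_cyc _) Z1 /\ same_cycle (infinity_cyc _) Z2) \/
              (same_cycle (infinity_cyc _) Z1 /\ same_cycle (origin_cyc _) Z2),
            same_cycle (origin_cyc _) Z1 -> same_cycle (infinity_cyc _) Z2 ->
              eqmod_ipi (dist C1 C2 Z1 Z2)
                ((Log (cm C1 / ck C1)%:C - Log (cm C2 / ck C2)%:C) / 2%:R)
          & same_cycle (origin_cyc _) Z1 -> same_cycle (infinity_cyc _) Z2 ->
            0 < cm C1 / ck C1 -> 0 < cm C2 / ck C2 ->
              dist C1 C2 Z1 Z2 =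
                ((ln (cm C1 / ck C1) - ln (cm C2 / ck C2)) / 2%:R)%:C])].
Proof.
split.
- move=> M C1 C2 C Z1 Z2 dM aZ; split.
  + exact: associated_mobius.
  + exact: dist_mobius.
  + by move=> D1 D2 D W1 W2 s1 s2; exact: dist_mobius_any dM aZ s1 s2.
- move=> z1 z2 C1 C2 y1 y2 z12 s1 s2; split; last first.
    by move=> C Z1 Z2; exact: dist_lobachevsky.
  have [D [Z1 [Z2 [aZ _ _]]]] := dist_points y1 y2 z12.
  by exists D, Z1, Z2; exact: associated_same aZ.
- move=> C1 C2 C3 C Z1 Z2 aZ nz3 o3 n31 n32.
  have [_ _ _ [n11 n12 n21 n22]] := aZ.
  split.
  + exact: associated_replace aZ nz3 o3 n31 n32.
  + exact: associated_replace (associated_swap aZ) nz3 o3 n31 n32.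
  + exact: dist_additive.
  + exact: dist_additive_pos.
- move=> C1 C2 C Z1 Z2 k1 k2 /(cl_centre k1) l1 /(cl_centre k2) l2 aZ.
  have [_ _ _ [n11 n12 n21 n22]] := aZ.
  split.
  + exact: vertical_ends l1 l2 aZ.
  + exact: dist_vertical.
  + move=> sZ1 sZ2 p1 p2; rewrite -ln_div ?posrE //.
    by apply: dist_pos; [exact: divr_gt0|exact: cross_ratio_vertical].
Qed.
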